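(* Let $L$ be a language expanding the language of ordered rings and containing unary function symbols $\sin$, $\cos$ and a constant symbol $\pi$, and let $T$ be an $L$-theory expanding the theory of ordered fields. If $T$ defines a restricted sine, then $T$ does not admit generic derivations.
   Context: For $\mathcal{K}\models T$ with domain $K$, let $D$ be the interval $[0,2\pi) \subseteq K$ with addition modulo $2\pi$ (an abelian group), let $\mathbb{C}_K = K + iK$ (with $i^2=-1$) and $\mathbb{C}_K^*$ its multiplicative group. $\mathcal{K}$ defines a restricted sine if $\pi > 0$ and the map $F : D \to \mathbb{C}_K^*$, $x \mapsto \sin x + i\cos x$, is a group homomorphism which is not constant; $T$ defines a restricted sine if this holds in every model of $T$. $T_M$ is the Morleyization of $T$ (a new relation symbol for each $L$-formula), and $T_M^\delta$ is $T_M$ together with a new unary function symbol $\delta$ and axioms $\delta(x+y)=\delta x+\delta y$, $\delta(xy)=x\,\delta y+y\,\delta x$. $T$ admits generic derivations if $T_M^\delta$ has a model companion, i.e. the class of existentially closed models of $T_M^\delta$ is elementary.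
   Formalization: The theory T is assumed consistent (it has a model); an inconsistent T vacuously defines a restricted sine, yet its class of existentially closed models is empty and hence elementary, so the claim fails there. *)

(* Defs.v *)
From mathcomp Require Import all_boot.


Record signature := Sig {
  sfun : Type; sfar : sfun -> nat;
  srel : Type; srar : srel -> nat }.

Inductive term (S : signature) : Type :=
  | Var : nat -> term S
  | App : forall f : sfun S, ('I_(sfar S f) -> term S) -> term S.

Inductive formula (S : signature) : Type :=
  | Fal : formula S
  | Eqf : term S -> term S -> formula S
  | Relf : forall r : srel S, ('I_(srar S r) -> term S) -> formula S
  | Imp : formula S -> formula S -> formula S
  | Andf : formula S -> formula S -> formula S
  | Orf : formula S -> formula S -> formula S
  | Exf : nat -> formula S -> formula S
  | Allf : nat -> formula S -> formula S.

Arguments Var {S}.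
Arguments Fal {S}.
Arguments App {S}.
Arguments Eqf {S}.
Arguments Relf {S}.
Arguments Imp {S}.
Arguments Andf {S}.
Arguments Orf {S}.
Arguments Exf {S}.
Arguments Allf {S}.

Set Implicit Arguments.
Unset Strict Implicit.
Unset Printing Implicit Defensive.

(* a theory = a set of formulas (read as their universal closures) *)
Definition theory (S : signature) := formula S -> Prop.

Record structure (S : signature) := Struct {
  dom : Type;
  fint : forall f : sfun S, ('I_(sfar S f) -> dom) -> dom;
  rint : forall r : srel S, ('I_(srar S r) -> dom) -> Prop }.
Arguments dom {S} s.
Arguments fint {S} s f _.
Arguments rint {S} s r _.

Definition upd {A : Type} (rho : nat -> A) (x : nat) (d : A) : nat -> A :=
  fun n => if n == x then d else rho n.

Fixpoint eval (S : signature) (M : structure S) (rho : nat -> dom M)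
  (t : term S) : dom M :=
  match t with
  | Var k => rho k
  | App f a => fint M f (fun i => eval rho (a i))
  end.

Fixpoint sat (S : signature) (M : structure S) (rho : nat -> dom M)
  (phi : formula S) : Prop :=
  match phi with
  | Fal => False
  | Eqf t u => eval rho t = eval rho u
  | Relf r a => rint M r (fun i => eval rho (a i))
  | Imp p q => sat rho p -> sat rho q
  | Andf p q => sat rho p /\ sat rho q
  | Orf p q => sat rho p \/ sat rho q
  | Exf x p => exists d : dom M, sat (upd rho x d) p
  | Allf x p => forall d : dom M, sat (upd rho x d) p
  end.

Definition models (S : signature) (T : theory S) (M : structure S) : Prop :=
  forall phi, T phi -> forall rho : nat -> dom M, sat rho phi.

Fixpoint qf (S : signature) (phi : formula S) : Prop :=
  match phi with
  | Fal | Eqf _ _ | Relf _ _ => True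
  | Imp p q | Andf p q | Orf p q => qf p /\ qf q
  | Exf _ _ | Allf _ _ => False
  end.

Fixpoint existential (S : signature) (phi : formula S) : Prop :=
  match phi with
  | Exf _ p => existential p
  | _ => qf phi
  end.

Definition embedding (S : signature) (M N : structure S)
  (h : dom M -> dom N) : Prop :=
  injective h /\
  (forall f (a : 'I_(sfar S f) -> dom M), h (fint M f a) = fint N f (h \o a)) /\
  (forall r (a : 'I_(srar S r) -> dom M), rint M r a <-> rint N r (h \o a)).

Definition ec_model (S : signature) (T : theory S) (M : structure S) : Prop :=
  models T M /\
  forall (N : structure S) (h : dom M -> dom N),
    models T N -> embedding h ->
    forall (phi : formula S) (rho : nat -> dom M),
      existential phi -> sat (h \o rho) phi -> sat rho phi.

Definition has_model_companion (S : signature) (T : theory S) : Prop :=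
  exists Sigma : theory S,
    forall M : structure S, models Sigma M <-> ec_model T M.

Fixpoint bnd_term (S : signature) (P : nat -> Prop) (t : term S) : Prop :=
  match t with
  | Var k => P k
  | App f a => forall i, bnd_term P (a i)
  end.

Fixpoint bnd (S : signature) (P : nat -> Prop) (phi : formula S) : Prop :=
  match phi with
  | Fal => True
  | Eqf t u => bnd_term P t /\ bnd_term P u
  | Relf r a => forall i, bnd_term P (a i)
  | Imp p q | Andf p q | Orf p q => bnd P p /\ bnd P q
  | Exf x p | Allf x p => bnd (fun k => k = x \/ P k) p
  end.

(* one n-ary relation symbol R_(phi,n) for each formula phi whose free
   variables are among x_0, ..., x_(n-1) *)
Definition morley_idx (S : signature) :=
  {p : formula S * nat | bnd (fun k => k < p.2) p.1}.

(* the language L_M expanded by delta: function symbols Some f (from L)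
   and None (= delta, unary); relation symbols inl r (from L) and
   inr m (Morleyization) *)
Definition sigMd (S : signature) : signature :=
  Sig (option (sfun S)) (fun o : option (sfun S) =>
         match o with Some f => sfar S f | None => 1 end)
      (srel S + morley_idx S) (fun r : srel S + morley_idx S =>
         match r with inl r => srar S r | inr m => (proj1_sig m).2 end).

Fixpoint emb_term (S : signature) (t : term S) : term (sigMd S) :=
  match t with
  | Var k => Var k
  | App f a => @App (sigMd S) (Some f) (fun i => emb_term (a i))
  end.

Fixpoint emb (S : signature) (phi : formula S) : formula (sigMd S) :=
  match phi with
  | Fal => Fal
  | Eqf t u => Eqf (emb_term t) (emb_term u)
  | Relf r a => @Relf (sigMd S) (inl r) (fun i => emb_term (a i))
  | Imp p q => Imp (emb p) (emb q)
  | Andf p q => Andf (emb p) (emb q)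
  | Orf p q => Orf (emb p) (emb q)
  | Exf x p => Exf x (emb p)
  | Allf x p => Allf x (emb p)
  end.

Definition morley_ax (S : signature) (m : morley_idx S) : formula (sigMd S) :=
  let R := @Relf (sigMd S) (inr m) (fun i => Var (nat_of_ord i)) in
  Andf (Imp R (emb (proj1_sig m).1)) (Imp (emb (proj1_sig m).1) R).

Inductive bfun := Fzero | Fone | Fadd | Fmul | Fopp | Fsin | Fcos | Fpi.

Definition bfun_ar (f : bfun) : nat :=
  match f with
  | Fzero | Fone | Fpi => 0
  | Fadd | Fmul => 2
  | Fopp | Fsin | Fcos => 1
  end.

(* extra function symbols F0 (arities fa0), extra relation symbols R0
   (arities ra0); the relation symbol None is < (binary) *)
Definition Lsig (F0 : Type) (fa0 : F0 -> nat) (R0 : Type) (ra0 : R0 -> nat)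
  : signature :=
  Sig (bfun + F0) (fun f : bfun + F0 => match f with inl b => bfun_ar b | inr g => fa0 g end)
      (option R0) (fun r : option R0 => match r with Some r => ra0 r | None => 2 end).

Definition args0 {A : Type} : 'I_0 -> A :=
  fun i => False_rect A (notF (ltn_ord i)).
Definition args1 {A : Type} (a : A) : 'I_1 -> A := fun _ => a.
Definition args2 {A : Type} (a b : A) : 'I_2 -> A :=
  fun i => if nat_of_ord i == 0 then a else b.

Section Interp.
Variables (F0 : Type) (fa0 : F0 -> nat) (R0 : Type) (ra0 : R0 -> nat).
Variable M : structure (Lsig fa0 ra0).

Definition Mzero : dom M := fint M (inl Fzero) args0.
Definition Mone  : dom M := fint M (inl Fone) args0.
Definition Mpi   : dom M := fint M (inl Fpi) args0.
Definition Madd (x y : dom M) : dom M := fint M (inl Fadd) (args2 x y).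
Definition Mmul (x y : dom M) : dom M := fint M (inl Fmul) (args2 x y).
Definition Mopp (x : dom M) : dom M := fint M (inl Fopp) (args1 x).
Definition Msin (x : dom M) : dom M := fint M (inl Fsin) (args1 x).
Definition Mcos (x : dom M) : dom M := fint M (inl Fcos) (args1 x).
Definition Mlt (x y : dom M) : Prop := rint M None (args2 x y).
End Interp.

Definition is_ordered_field (K : Type) (z o : K) (add mul : K -> K -> K)
  (opp : K -> K) (lt : K -> K -> Prop) : Prop :=
  (forall x y w, add x (add y w) = add (add x y) w) /\
  (forall x y, add x y = add y x) /\
  (forall x, add z x = x) /\
  (forall x, add (opp x) x = z) /\
  (forall x y w, mul x (mul y w) = mul (mul x y) w) /\
  (forall x y, mul x y = mul y x) /\
  (forall x, mul o x = x) /\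
  (forall x y w, mul x (add y w) = add (mul x y) (mul x w)) /\
  o <> z /\
  (forall x, x <> z -> exists y, mul x y = o) /\
  (forall x, ~ lt x x) /\
  (forall x y w, lt x y -> lt y w -> lt x w) /\
  (forall x y, lt x y \/ x = y \/ lt y x) /\
  (forall x y w, lt x y -> lt (add x w) (add y w)) /\
  (forall x y, lt z x -> lt z y -> lt z (mul x y)).

Definition OF_model F0 fa0 R0 ra0 (M : structure (@Lsig F0 fa0 R0 ra0)) :=
  is_ordered_field (Mzero M) (Mone M) (@Madd _ _ _ _ M) (@Mmul _ _ _ _ M)
    (@Mopp _ _ _ _ M) (@Mlt _ _ _ _ M).

Definition expands_OF F0 fa0 R0 ra0 (T : theory (@Lsig F0 fa0 R0 ra0)) :=
  forall M, models T M -> OF_model M.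

(* M defines a restricted sine.  D = [0, 2pi); x (+) y = x + y if
   x + y < 2pi and x + y - 2pi otherwise; C_K = K + iK represented by
   pairs (a, b) = a + ib, with (a,b)(c,d) = (ac - bd, ad + bc);
   F x = sin x + i cos x = (sin x, cos x). *)
Section RSine.
Variables (F0 : Type) (fa0 : F0 -> nat) (R0 : Type) (ra0 : R0 -> nat).
Variable M : structure (Lsig fa0 ra0).
Local Notation K := (dom M).
Local Notation "x + y" := (Madd x y).
Local Notation "x * y" := (Mmul x y).
Local Notation "x < y" := (Mlt x y).

Definition twopi : K := Mpi M + Mpi M.
Definition inD (x : K) : Prop := ~ (x < Mzero M) /\ x < twopi.
Definition addD_rel (x y s : K) : Prop :=
  (x + y < twopi -> s = x + y) /\
  (~ (x + y < twopi) -> s = (x + y) + Mopp twopi).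
Definition Fsc (x : K) : K * K := (Msin x, Mcos x).
Definition cmul (u v : K * K) : K * K :=
  (u.1 * v.1 + Mopp (u.2 * v.2), u.1 * v.2 + u.2 * v.1).

Definition defines_rsine_in : Prop :=
  Mzero M < Mpi M /\
  (forall x, inD x -> Fsc x <> (Mzero M, Mzero M)) /\
  (forall x y s, inD x -> inD y -> addD_rel x y s -> Fsc s = cmul (Fsc x) (Fsc y)) /\
  (exists x y, inD x /\ inD y /\ Fsc x <> Fsc y).
End RSine.

Definition defines_rsine F0 fa0 R0 ra0 (T : theory (@Lsig F0 fa0 R0 ra0)) :=
  forall M, models T M -> defines_rsine_in M.

Section TMd.
Variables (F0 : Type) (fa0 : F0 -> nat) (R0 : Type) (ra0 : R0 -> nat).
Local Notation L := (Lsig fa0 ra0).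
Local Notation L' := (sigMd L).

Definition tdelta (t : term L') : term L' := @App L' None (args1 t).
Definition tadd (t u : term L') : term L' := @App L' (Some (inl Fadd)) (args2 t u).
Definition tmul (t u : term L') : term L' := @App L' (Some (inl Fmul)) (args2 t u).

Definition dax_add : formula L' :=
  Eqf (tdelta (tadd (Var 0) (Var 1))) (tadd (tdelta (Var 0)) (tdelta (Var 1))).
Definition dax_mul : formula L' :=
  Eqf (tdelta (tmul (Var 0) (Var 1)))
      (tadd (tmul (Var 0) (tdelta (Var 1))) (tmul (Var 1) (tdelta (Var 0)))).

Definition TMdelta (T : theory L) : theory L' :=
  fun psi =>
    (exists phi, T phi /\ psi = emb phi) \/
    (exists m : morley_idx L, psi = morley_ax m) \/
    psi = dax_add \/ psi = dax_mul.
End TMd.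

Definition admits_generic_derivations F0 fa0 R0 ra0
  (T : theory (@Lsig F0 fa0 R0 ra0)) : Prop :=
  has_model_companion (TMdelta T).

(* Main.v *)
Require Import Defs.
From HB Require Import structures.
From mathcomp Require Import all_boot all_order all_algebra.
From mathcomp Require Import boolp classical_sets filter.
From mathcomp Require Import ring lra zify.

(* A derivation of K extends to K + iK, and the rule F(x) F(bx)' = b F(bx) F(x)'
   then holds for every natural number b.  If the existentially closed models
   formed an elementary class, an ultrapower over nat of such a model would
   again be existentially closed, and by Los the rule would hold there for an
   infinite b.  On the monoid of those x >= 0 with n b x < 2 pi for every natural
   number n, the characters F(x)^i F(bx)^j are pairwise distinct, so by Artin's
   independence theorem no nonzero polynomial vanishes at (F(x), F(bx)) for all
   these x.  Hence some elementary extension contains an x for which F(x) and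
   F(bx) are algebraically independent; there delta extends to a derivation
   breaking the rule at x, and existential closedness pulls this back: a
   contradiction.

   Existentially closed models exist: by Zorn and compactness every model has an
   extension realising a maximal set of existential formulas over it.  Iterate
   this omega times; since embeddings of Morleyized models are elementary, the
   limit is a model. *)

Set Implicit Arguments.
Unset Strict Implicit.
Unset Printing Implicit Defensive.

Local Open Scope classical_set_scope.


(** The rule is the logarithmic derivative of F(bx) = F(x)^b, which the homomorphism law yields for
    natural b only. That law is plain addition only as long as sums stay below the period; hence the
    monoid of small x, on which no (i + jb)x wraps around. It has elements with F different from 1
    because F is not constant and F(z/n)^n = F(z). The obstacle is the passage from K + iK back to
    K. Independence permits a derivation of K + iK with F(x)' = 0 and F(bx)' = 1, but such a
    derivation need not preserve K, whereas delta must live on K. Its real and imaginary parts do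
    give derivations of K. As the rule is linear in the derivation, it cannot hold for all real
    combinations that extend delta. *)

Lemma sig_inj (A : Type) (P : A -> Prop) (x y : {a | P a}) :
  proj1_sig x = proj1_sig y -> x = y.
Proof. by apply: eq_sig_hprop => a p q; exact: Prop_irrelevance. Qed.

(** The common source of all ultrafilters below: free ones on [nat] from the tails, compactness from
    a chain of sets of formulas, and generic points from the nonzero sets of polynomials. *)
Lemma directed_ultrafilter (J I : Type) (B : J -> set I) :
  (exists _ : J, True) ->
  (forall j k, exists l, B l `<=` B j `&` B k) ->
  (forall j, B j !=set0) ->
  exists U : set_system I, UltraFilter U /\ forall j, U (B j).
Proof.
move=> J0 Bdir B0.
have FF : Filter (filter_from setT B) by exact: filter_fromT_filter.
have PF : ProperFilter (filter_from setT B) by apply: filter_from_proper.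
have [U [UU FU]] := ultraFilterLemma PF.
by exists U; split=> // j; apply: FU; exists j.
Qed.

(** * Ultrafilters and the logical connectives *)

Section UltrafilterLogic.
Variables (I : Type) (U : set_system I).
Hypothesis UU : UltraFilter U.

Lemma ultra_imp (A B : set I) : U [set i | A i -> B i] <-> (U A -> U B).
Proof.
split=> [UAB UA|UAB].
  by apply: filterS (filterI UAB UA) => i [ab a]; exact: ab.
have [UA|UA] := in_ultra_setVsetC A UU.
  by apply: filterS (UAB UA) => i Bi _.
by apply: filterS UA => i nA /nA.
Qed.

Lemma ultra_and (A B : set I) : U [set i | A i /\ B i] <-> (U A /\ U B).
Proof.
split=> [UAB|[UA UB]]; last exact: filterI.
by split; apply: filterS UAB => i [].
Qed.

Lemma ultra_not (A : set I) : U [set i | ~ A i] <-> ~ U A.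
Proof.
split=> [UnA UA|UnA].
  by have [i []] := filter_ex (filterI UnA UA).
by have [|//] := in_ultra_setVsetC A UU.
Qed.

Lemma ultra_or (A B : set I) : U [set i | A i \/ B i] <-> (U A \/ U B).
Proof.
split=> [UAB|]; last first.
  by case; apply: filterS => i; [left|right].
have [UA|UA] := in_ultra_setVsetC A UU; first by left.
by right; apply: filterS (filterI UAB UA) => i [[]].
Qed.

Lemma ultra_forall n (A : 'I_n -> set I) :
  U [set i | forall k, A k i] <-> forall k, U (A k).
Proof.
split=> [UA k|UA]; first by apply: filterS UA => i.
exact: filter_forall.
Qed.

End UltrafilterLogic.

(** * Ultraproducts *)

Section Ultraproduct.
Variables (S : signature) (I : Type) (U : set_system I) (M : I -> structure S).
Let sec := forall i, dom (M i).

Definition ueq_class (f : sec) : set sec := [set g | U [set i | f i = g i]].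
(** A class is kept as a set of sections, so that equality modulo [U] becomes Leibniz equality,
    which is what [sat] uses for [Eqf]. Operations go through chosen representatives; [fint_ucl] and
    [rint_ucl] show that the choice does not matter. *)
Definition udom : Type := {c : set sec | exists f, c = ueq_class f}.
Definition ucl (f : sec) : udom :=
  exist _ (ueq_class f) (ex_intro _ f erefl).
Definition urep (x : udom) : sec := projT1 (cid (proj2_sig x)).

Definition ultraproduct : structure S :=
  @Struct S udom
    (fun f a => ucl (fun i => fint (M i) f (fun k => urep (a k) i)))
    (fun r a => U [set i | rint (M i) r (fun k => urep (a k) i)]).

Hypothesis UU : UltraFilter U.

Lemma urepK x : ucl (urep x) = x.
Proof.
by case: x => c cP; apply: sig_inj; rewrite /urep /=; case: cid.
Qed.

Lemma ucl_eq f g : ucl f = ucl g <-> U [set i | f i = g i].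
Proof.
split=> [[/(congr1 (fun c => c g))]|Ufg].
  by rewrite /ueq_class /= => ->; apply: filterS filterT.
apply: sig_inj; apply/seteqP; split=> h /= Uh.
  by apply: filterS (filterI Ufg Uh) => i [/= <-].
by apply: filterS (filterI Ufg Uh) => i [/= ->].
Qed.

Lemma urep_ucl f : U [set i | urep (ucl f) i = f i].
Proof. by apply/ucl_eq; rewrite urepK. Qed.

Lemma eval_ultraproduct (rho : nat -> sec) (t : term S) :
  @eval S ultraproduct (fun n => ucl (rho n)) t =
  ucl (fun i => @eval S (M i) (fun n => rho n i) t).
Proof.
elim: t => [n|f a IH] //=; apply/ucl_eq.
have : U [set i | forall k, urep (@eval S ultraproduct (fun n => ucl (rho n)) (a k)) i
   = @eval S (M i) (fun n => rho n i) (a k)].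
  by apply/ultra_forall => k; rewrite IH; exact: urep_ucl.
by apply: filterS => i /= E; congr fint; apply: funext.
Qed.

Lemma upd_ucl (rho : nat -> sec) x (f : sec) :
  upd (fun n => ucl (rho n)) x (ucl f) =
  (fun n => ucl (upd rho x f n)).
Proof. by apply: funext => n; rewrite /upd; case: eqP. Qed.

Lemma upd_sec (rho : nat -> sec) x (f : sec) i :
  (fun n => upd rho x f n i) = upd (fun n => rho n i) x (f i).
Proof. by apply: funext => n; rewrite /upd; case: eqP. Qed.

Lemma los (rho : nat -> sec) (phi : formula S) :
  @sat S ultraproduct (fun n => ucl (rho n)) phi <->
  U [set i | @sat S (M i) (fun n => rho n i) phi].
Proof.
elim: phi rho => [|t u|r a|p IHp q IHq|p IHp q IHq|p IHp q IHq|x p IHp|x p IHp] rho /=.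
- split=> // /filter_ex[]//.
- by rewrite !eval_ultraproduct ucl_eq.
- have E : U [set i | forall k, urep (@eval S ultraproduct (fun n => ucl (rho n)) (a k)) i
     = @eval S (M i) (fun n => rho n i) (a k)].
    by apply/ultra_forall => k; rewrite eval_ultraproduct; exact: urep_ucl.
  by split=> H; apply: filterS (filterI E H) => i [/= /funext ->].
- by rewrite ultra_imp IHp IHq.
- by rewrite ultra_and IHp IHq.
- by rewrite ultra_or IHp IHq.
- split=> [[d]|H].
    rewrite -(urepK d) upd_ucl IHp; apply: filterS => i /=.
    by rewrite upd_sec; exists (urep d i).
  (* A coordinatewise witness; [rho 0 i] is a default at coordinates without one, a set outside
     [U]. *)
  pose f i := if pselect (exists d, @sat S (M i) (upd (fun n => rho n i) x d) p)
    is left e then projT1 (cid e) else rho 0 i.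
  exists (ucl f); rewrite upd_ucl IHp; apply: filterS H => i /=.
  by rewrite upd_sec /f; case: pselect => // e _; case: cid.
- split=> [H|H d]; last first.
    rewrite -(urepK d) upd_ucl IHp; apply: filterS H => i /=.
    by rewrite upd_sec; exact.
  (* Coordinatewise counterexamples where they exist: if [p] holds at this one section, it holds for
     every [d] at almost all coordinates. *)
  pose f i := if pselect (exists d, ~ @sat S (M i) (upd (fun n => rho n i) x d) p)
    is left e then projT1 (cid e) else rho 0 i.
  move: (H (ucl f)); rewrite upd_ucl IHp; apply: filterS => i /=.
  rewrite upd_sec /f; case: pselect => [e|ne _ d]; first by case: cid.
  by apply: contrapT => nd; apply: ne; exists d.
Qed.

Lemma los_urep (rho : nat -> udom) (phi : formula S) :
  @sat S ultraproduct rho phi <->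
  U [set i | @sat S (M i) (fun n => urep (rho n) i) phi].
Proof.
rewrite -los; suff -> : (fun n => ucl (urep (rho n))) = rho by [].
by apply: funext => n; rewrite urepK.
Qed.

Lemma models_ultraproduct (T : theory S) :
  (forall i, models T (M i)) -> models T ultraproduct.
Proof.
move=> TM phi Tphi rho; apply/los_urep.
by apply: filterS filterT => i _; exact: TM.
Qed.

Lemma embedding_ultraproduct (N : structure S) (h : forall i, dom N -> dom (M i)) :
  (forall i, embedding (h i)) ->
  @embedding S N ultraproduct (fun d => ucl (fun i => h i d)).
Proof.
move=> hemb.
have E n (a : 'I_n -> dom N) :
    U [set i | (fun k => urep (ucl (fun i => h i (a k))) i) = h i \o a].
  have : U [set i | forall k, urep (ucl (fun i => h i (a k))) i = h i (a k)].
    by apply/ultra_forall => k; exact: urep_ucl.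
  by apply: filterS => i /= /funext.
split=> [x y /ucl_eq/filter_ex[i]|]; first exact: (hemb i).1.
split=> [f a|r a] /=.
  apply/ucl_eq; apply: filterS (E _ a) => i /= ->.
  by rewrite (hemb i).2.1.
split=> [H|H].
  apply: filterS (E _ a) => i /= ->.
  by apply/(hemb i).2.2.
by have [i [/= -> /(hemb i).2.2]] := filter_ex (filterI (E _ a) H).
Qed.

End Ultraproduct.


Section UltraproductBasic.
Variables (S : signature) (I : Type) (U : set_system I) (M : I -> structure S).
Hypothesis UU : UltraFilter U.

Lemma urep_ucl_fin n (s : 'I_n -> forall i, dom (M i)) :
  U [set i | (fun k => urep (ucl U (s k)) i) = fun k => s k i].
Proof.
have : U [set i | forall k, urep (ucl U (s k)) i = s k i].
  by apply/ultra_forall => k; exact: urep_ucl.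
by apply: filterS => i /= /funext.
Qed.

Lemma fint_ucl f (s : 'I_(sfar S f) -> forall i, dom (M i)) :
  fint (ultraproduct U M) f (fun k => ucl U (s k)) =
  ucl U (fun i => fint (M i) f (fun k => s k i)).
Proof. by apply/ucl_eq; apply: filterS (urep_ucl_fin s) => i /= ->. Qed.

Lemma rint_ucl r (s : 'I_(srar S r) -> forall i, dom (M i)) :
  rint (ultraproduct U M) r (fun k => ucl U (s k)) <->
  U [set i | rint (M i) r (fun k => s k i)].
Proof.
by split=> H; apply: filterS (filterI (urep_ucl_fin s) H) => i /= [->].
Qed.

End UltraproductBasic.

(** * Formulas and embeddings *)

Section FreeVariables.
Variable S : signature.

Lemma bnd_term_mono (P Q : nat -> Prop) (t : term S) :
  (forall k, P k -> Q k) -> bnd_term P t -> bnd_term Q t.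
Proof.
move=> PQ; elim: t => [n|f a IH] /=; first exact: PQ.
by move=> H i; apply: IH.
Qed.

Lemma bnd_mono (P Q : nat -> Prop) (phi : formula S) :
  (forall k, P k -> Q k) -> bnd P phi -> bnd Q phi.
Proof.
elim: phi P Q => [|t u|r a|p IHp q IHq|p IHp q IHq|p IHp q IHq|x p IHp|x p IHp]
  P Q PQ //=.
- by case=> *; split; apply: bnd_term_mono PQ _.
- by move=> H i; apply: bnd_term_mono PQ _.
- by case=> *; split; [apply: IHp PQ _|apply: IHq PQ _].
- by case=> *; split; [apply: IHp PQ _|apply: IHq PQ _].
- by case=> *; split; [apply: IHp PQ _|apply: IHq PQ _].
- by apply: IHp => k [->|/PQ]; [left|right].
- by apply: IHp => k [->|/PQ]; [left|right].
Qed.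

Lemma bnd_term_ex (t : term S) : exists n, bnd_term (fun k => k < n) t.
Proof.
elim: t => [n|f a IH]; first by exists n.+1 => /=.
have [N HN] := choice IH.
exists (\max_i N i) => /= i; apply: bnd_term_mono (HN i) => k kN.
by apply: leq_trans kN _; apply: leq_bigmax.
Qed.

Lemma bnd_ex (phi : formula S) : exists n, bnd (fun k => k < n) phi.
Proof.
have ltm m n k : (k < m)%N -> (k < maxn m n)%N /\ (k < maxn n m)%N.
  by move=> km; rewrite !leq_max km orbT.
have two (A B : (nat -> Prop) -> Prop) :
    (forall P Q : nat -> Prop, (forall k, P k -> Q k) -> A P -> A Q) ->
    (forall P Q : nat -> Prop, (forall k, P k -> Q k) -> B P -> B Q) ->
    (exists n, A (fun k => k < n)) -> (exists n, B (fun k => k < n)) ->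
    exists n, A (fun k => k < n) /\ B (fun k => k < n).
  move=> mA mB [m Am] [n Bn]; exists (maxn m n); split.
    by apply: mA Am => k /(ltm _ n)[].
  by apply: mB Bn => k /(ltm _ m)[].
elim: phi => [|t u|r a|p IHp q IHq|p IHp q IHq|p IHp q IHq|x p [n Hn]|x p [n Hn]] /=.
- by exists 0.
- apply: (two (fun P => bnd_term P t) (fun P => bnd_term P u)) => [P Q|P Q||];
    by [exact: bnd_term_mono|exact: bnd_term_ex].
- have [N HN] := choice (fun i => bnd_term_ex (a i)).
  exists (\max_i N i) => /= i; apply: bnd_term_mono (HN i) => k kN.
  by apply: leq_trans kN _; apply: leq_bigmax.
- by apply: (two (fun P => bnd P p) (fun P => bnd P q)) => [P Q|P Q||//];
    [exact: bnd_mono|exact: bnd_mono|].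
- by apply: (two (fun P => bnd P p) (fun P => bnd P q)) => [P Q|P Q||//];
    [exact: bnd_mono|exact: bnd_mono|].
- by apply: (two (fun P => bnd P p) (fun P => bnd P q)) => [P Q|P Q||//];
    [exact: bnd_mono|exact: bnd_mono|].
- by exists n; apply: bnd_mono Hn => k; right.
- by exists n; apply: bnd_mono Hn => k; right.
Qed.

Variable M : structure S.

Lemma eval_bnd (P : nat -> Prop) (rho rho' : nat -> dom M) (t : term S) :
  bnd_term P t -> (forall k, P k -> rho k = rho' k) ->
  eval rho t = eval rho' t.
Proof.
move=> + E; elim: t => [n|f a IH] /=; first exact: E.
by move=> H; congr fint; apply: funext => i; apply: IH.
Qed.

Lemma sat_bnd (P : nat -> Prop) (rho rho' : nat -> dom M) (phi : formula S) :
  bnd P phi -> (forall k, P k -> rho k = rho' k) ->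
  sat rho phi <-> sat rho' phi.
Proof.
have updE Q x (r r' : nat -> dom M) d : (forall k, Q k -> r k = r' k) ->
    forall k, k = x \/ Q k -> upd r x d k = upd r' x d k.
  by move=> E k; rewrite /upd; case: eqP => // kx [/kx//|/E].
elim: phi P rho rho' => [|t u|r a|p IHp q IHq|p IHp q IHq|p IHp q IHq|x p IHp|x p IHp]
  P rho rho' //=.
- by case=> bt bu E; rewrite (eval_bnd bt E) (eval_bnd bu E).
- move=> H E; suff -> : (fun i => eval rho (a i)) = (fun i => eval rho' (a i)) by [].
  by apply: funext => i; apply: eval_bnd E.
- by case=> bp bq E; rewrite (IHp _ _ _ bp E) (IHq _ _ _ bq E).
- by case=> bp bq E; rewrite (IHp _ _ _ bp E) (IHq _ _ _ bq E).
- by case=> bp bq E; rewrite (IHp _ _ _ bp E) (IHq _ _ _ bq E).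
- by move=> bp E; split=> -[d H]; exists d; move: H;
    rewrite (IHp _ _ _ bp (updE _ x _ _ d E)).
- by move=> bp E; split=> H d; move: (H d);
    rewrite (IHp _ _ _ bp (updE _ x _ _ d E)).
Qed.

End FreeVariables.

Section Embeddings.
Variables (S : signature).

Lemma comp_upd (A B : Type) (h : A -> B) rho x d :
  h \o upd rho x d = upd (h \o rho) x (h d).
Proof. by apply: funext => k; rewrite /upd /=; case: eqP. Qed.

Lemma embedding_id (M : structure S) : @embedding S M M id.
Proof. by split=> [x y|]; last by split. Qed.

Lemma embedding_comp (M N Q : structure S) (g : dom N -> dom Q) (h : dom M -> dom N) :
  embedding g -> embedding h -> @embedding S M Q (g \o h).
Proof.
move=> [ig [fg rg]] [ih [fh rh]]; split; first exact: inj_comp.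
by split=> [f a|r a]; [rewrite -fg -fh|rewrite rh rg].
Qed.

Variables (M N : structure S) (h : dom M -> dom N).
Hypothesis hemb : embedding h.

Lemma eval_embedding rho t : h (eval rho t) = eval (h \o rho) t.
Proof.
elim: t => [//|f a IH] /=; rewrite hemb.2.1; congr fint.
by apply: funext => i /=.
Qed.

Lemma qf_embedding rho phi : qf phi -> sat rho phi <-> sat (h \o rho) phi.
Proof.
elim: phi => [|t u|r a|p IHp q IHq|p IHp q IHq|p IHp q IHq|x p IHp|x p IHp] //=.
- by move=> _; rewrite -!eval_embedding; split=> [->|/hemb.1].
- move=> _; rewrite hemb.2.2.
  suff -> : h \o (fun i => eval rho (a i)) = (fun i => eval (h \o rho) (a i)) by [].
  by apply: funext => i /=; rewrite eval_embedding.
- by case=> /IHp -> /IHq ->.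
- by case=> /IHp -> /IHq ->.
- by case=> /IHp -> /IHq ->.
Qed.

Lemma existential_embedding rho phi :
  existential phi -> sat rho phi -> sat (h \o rho) phi.
Proof.
elim: phi rho => [|t u|r a|p _ q _|p _ q _|p _ q _|x p IHp|x p _] rho;
  try by move=> H; rewrite -qf_embedding.
by move=> /= Hp [d Hd]; exists (h d); rewrite -comp_upd; apply: IHp.
Qed.

End Embeddings.

(** * Existentially closed models *)

(** One step towards existential closedness: [M'] decides existential formulas as well as any
    extension of it, but only for parameters coming from [M]. *)
Definition max_extension (S : signature) (Th : theory S) (M M' : structure S)
    (h : dom M -> dom M') :=
  forall (N : structure S) (g : dom M' -> dom N),
    models Th N -> embedding g ->
    forall phi (rho : nat -> dom M), existential phi ->
      sat (g \o h \o rho) phi -> sat (h \o rho) phi.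

(** Zorn is applied to sets of formulas with assignments in [M], since the extensions of [M]
    themselves do not form a set. The union of a chain of realised sets is realised in an
    ultraproduct of the structures realising its members. *)
Lemma max_extension_ex (S : signature) (Th : theory S) (M : structure S) :
  models Th M ->
  exists (M' : structure S) (h : dom M -> dom M'),
    [/\ models Th M', embedding h & max_extension Th h].
Proof.
move=> ThM.
pose realizes (A : set (formula S * (nat -> dom M))) (N : structure S) h :=
  [/\ models Th N, @embedding S M N h & forall p, A p -> sat (h \o p.2) p.1].
pose P (A : set (formula S * (nat -> dom M))) :=
  (forall p, A p -> existential p.1) /\ exists N h, realizes A N h.
have [|A [[exA [N [h [ThN hemb satN]]]] maxA]] := @Zorn_bigcup _ P.
- move=> F FP Ftot; split=> [p [A FA Ap]|]; first exact: (FP A FA).1.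
  have [[A0 FA0]|F0] := pselect (exists A, F A); last first.
    exists M, id; split=> [//||p [A FA _]]; first exact: embedding_id.
    by case: F0; exists A.
  pose I := {A | F A}.
  have real (i : I) : {N : structure S & {h : dom M -> dom N | realizes (sval i) N h}}.
    by have /cid[N /cid[h H]] := (FP _ (svalP i)).2; exists N, h.
  pose N i := projT1 (real i); pose h i : dom M -> dom (N i) := sval (projT2 (real i)).
  have hP i : realizes (sval i) (N i) (h i) by exact: svalP (projT2 (real i)).
  (* Almost every member of the chain contains any given one, so each pair in the union is realised
     at almost all coordinates. *)
  have [||| U [UU UB]] := @directed_ultrafilter I I (fun i => [set j | sval i `<=` sval j]).
  + by exists (exist _ A0 FA0).
  + move=> i j; have [ij|ji] := Ftot _ _ (svalP i) (svalP j).
      by exists j => k jk; split=> //; exact: subset_trans ij jk.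
    by exists i => k ik; split=> //; exact: subset_trans ji ik.
  + by move=> i; exists i => /=.
  exists (ultraproduct U N), (fun d => ucl U (fun i => h i d)); split.
  + by apply: models_ultraproduct => i; case: (hP i).
  + by apply: embedding_ultraproduct => i; case: (hP i).
  move=> p [A FA Ap].
  apply/(@los _ _ U N UU (fun n i => h i (p.2 n))).
  apply: filterS (UB (exist _ A FA)) => i /= Ai.
  by have [_ _] := hP i; apply; apply: Ai.
exists N, h; split=> // Q g ThQ gemb phi rho ephi satphi.
have [AP|nAP] := pselect (A (phi, rho)); first exact: satN AP.
(* Pairs already realised in [N] stay realised in [Q] because existential formulas persist upwards,
   so the new pair could be added. *)
exfalso; apply: (maxA (A `|` [set (phi, rho)])).
  split; first by move=> p Ap; left.
  by move=> /(_ (phi, rho)) H; apply: nAP; apply: H; right.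
split=> [p [/exA//|-> //]|].
exists Q, (g \o h); split=> //; first exact: embedding_comp.
move=> p [Ap|-> //].
by apply: (existential_embedding gemb); [exact: exA|exact: satN].
Qed.


(** * Limits of chains of embeddings *)

Section ChainLimit.
Variables (S : signature) (M : nat -> structure S).
Variable h : forall n, dom (M n) -> dom (M n.+1).
Hypothesis hemb : forall n, embedding (@h n).
Variable x0 : dom (M 0).

(* [thread d] is a section of the chain passing through [d]; its values before
   stage [n] are irrelevant. *)
Fixpoint thread n (d : dom (M n)) m : dom (M m) :=
  match pselect (n = m) with
  | left e => eq_rect n (fun k => dom (M k)) d m e
  | right _ => match m return dom (M m) with
               | 0 => x0
               | m'.+1 => h (thread d m')
               end
  end.

Lemma thread_diag n (d : dom (M n)) : thread d n = d.
Proof.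
by case: n d => [|n] d /=; case: pselect => // e; rewrite (eq_irrelevance e erefl).
Qed.

Lemma threadS n (d : dom (M n)) m : n <= m -> thread d m.+1 = h (thread d m).
Proof. by move=> nm /=; case: pselect => // e; exfalso; move: nm; rewrite e ltnn. Qed.

Lemma thread_step n (d : dom (M n)) m : n < m -> thread (h d) m = thread d m.
Proof.
elim: m => // m IH; rewrite ltnS leq_eqVlt => /orP[/eqP nm|nm].
  by subst m; rewrite thread_diag threadS // thread_diag.
by rewrite threadS // threadS ?IH // ltnW.
Qed.

Lemma embedding_thread n m : n <= m -> embedding (fun d : dom (M n) => thread d m).
Proof.
elim: m => [|m IH].
  rewrite leqn0 => /eqP n0; subst n.
  have -> : (fun d : dom (M 0) => thread d 0) = id.
    by apply: funext => d; exact: thread_diag.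
  exact: embedding_id.
rewrite leq_eqVlt => /orP[/eqP nm|nm].
  subst n; have -> : (fun d : dom (M m.+1) => thread d m.+1) = id.
    by apply: funext => d; exact: thread_diag.
  exact: embedding_id.
have -> : (fun d : dom (M n) => thread d m.+1) = @h m \o (fun d => thread d m).
  by apply: funext => d; exact: threadS.
exact: embedding_comp (hemb m) (IH nm).
Qed.

Variables (U : set_system nat) (UU : UltraFilter U).
Hypothesis Uoo : forall n, U [set m | n <= m].

(** The direct limit is cut out of an ultraproduct along a free ultrafilter, as the set of classes
    of threads. Threads that agree from some stage on have the same class, so no quotient of a
    disjoint union of stages is needed. *)
Let in_limit (x : udom U M) := exists n (d : dom (M n)), x = ucl U (thread d).

Lemma ucl_thread_step n (d : dom (M n)) : ucl U (thread (h d)) = ucl U (thread d).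
Proof.
by apply/ucl_eq; apply: filterS (Uoo n.+1) => m; exact: thread_step.
Qed.

Lemma ucl_thread_later n (d : dom (M n)) m :
  n <= m -> ucl U (thread (thread d m)) = ucl U (thread d).
Proof.
elim: m => [|m IH].
  by rewrite leqn0 => /eqP n0; subst n; rewrite thread_diag.
rewrite leq_eqVlt => /orP[/eqP nm|nm].
  by subst n; rewrite thread_diag.
by rewrite threadS // ucl_thread_step IH.
Qed.

Lemma in_limit_fin k (a : 'I_k -> udom U M) : (forall i, in_limit (a i)) ->
  exists n (b : 'I_k -> dom (M n)), a = fun i => ucl U (thread (b i)).
Proof.
move=> /choice[N HN].
have H i : exists d : dom (M (\max_j N j)), a i = ucl U (thread d).
  have [d ->] := HN i; exists (thread d (\max_j N j)).
  by rewrite ucl_thread_later //; apply: leq_bigmax.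
by have [b Hb] := choice H; exists (\max_j N j), b; exact: funext.
Qed.

Lemma fint_thread f n (b : 'I_(sfar S f) -> dom (M n)) :
  fint (ultraproduct U M) f (fun i => ucl U (thread (b i))) =
  ucl U (thread (fint (M n) f b)).
Proof.
rewrite fint_ucl; apply/ucl_eq; apply: filterS (Uoo n) => m /= nm.
by rewrite (embedding_thread nm).2.1.
Qed.

Lemma in_limit_fint f (a : 'I_(sfar S f) -> udom U M) :
  (forall i, in_limit (a i)) -> in_limit (fint (ultraproduct U M) f a).
Proof.
move=> /in_limit_fin[n [b ->]]; rewrite fint_thread.
by exists n, (fint (M n) f b).
Qed.

Definition chain_limit : structure S :=
  @Struct S {x | in_limit x}
    (fun f a => exist _ (fint (ultraproduct U M) f (fun i => sval (a i)))
                  (in_limit_fint (fun i => svalP (a i))))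
    (fun r a => rint (ultraproduct U M) r (fun i => sval (a i))).

Definition to_limit n (d : dom (M n)) : dom chain_limit :=
  exist _ (ucl U (thread d)) (ex_intro _ n (ex_intro _ d erefl)).

Lemma embedding_to_limit n : embedding (@to_limit n).
Proof.
split=> [d d' /(congr1 (@proj1_sig _ _))/= /ucl_eq Ud|].
  have [m [/= nm]] := filter_ex (filterI (Uoo n) Ud).
  exact: (embedding_thread nm).1.
split=> [f a|r a].
  apply: sig_inj; exact: (esym (fint_thread a)).
have -> : rint chain_limit r (@to_limit n \o a) =
  rint (ultraproduct U M) r (fun i => ucl U (thread (a i))) by [].
rewrite rint_ucl; split=> H.
  by apply: filterS (Uoo n) => m /= nm; apply/(embedding_thread nm).2.2.
have [m [/= nm]] := filter_ex (filterI (Uoo n) H).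
by move/(embedding_thread nm).2.2.
Qed.

Lemma to_limit_step n (d : dom (M n)) : to_limit (h d) = to_limit d.
Proof. by apply: sig_inj; exact: ucl_thread_step. Qed.

Lemma to_limit_later n (d : dom (M n)) m : n <= m ->
  to_limit (thread d m) = to_limit d.
Proof. by move=> nm; apply: sig_inj; exact: ucl_thread_later. Qed.

Lemma to_limit_surj (x : dom chain_limit) : exists n (d : dom (M n)), x = to_limit d.
Proof. by case: x => x [n [d xd]]; exists n, d; apply: sig_inj. Qed.

Lemma to_limit_env (rho : nat -> dom chain_limit) k :
  exists n (rho' : nat -> dom (M n)), forall j, j < k -> rho j = to_limit (rho' j).
Proof.
have [N HN] := choice (fun j => to_limit_surj (rho j)).
pose n := \max_(j < k) N j.
have H j : exists d : dom (M n), j < k -> rho j = to_limit d.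
  have [jk|] := ltnP j k; last by exists (thread x0 n).
  have [d ->] := HN j; exists (thread d n) => _; rewrite to_limit_later //.
  exact: (@leq_bigmax _ (fun j : 'I_k => N j) (Ordinal jk)).
by have [rho' H'] := choice H; exists n, rho'.
Qed.

End ChainLimit.


(** * Morleyization, reducts and expansions *)

Section Reduct.
Variable S : signature.

Definition reduct (N : structure (sigMd S)) : structure S :=
  @Struct S (dom N) (fun f => fint N (Some f : sfun (sigMd S)))
    (fun r => rint N (inl r : srel (sigMd S))).

Lemma eval_emb (N : structure (sigMd S)) rho (t : term S) :
  @eval _ N rho (emb_term t) = @eval _ (reduct N) rho t.
Proof.
by elim: t => [//|f a IH] /=; congr (fint N _); apply: funext => i; exact: IH.
Qed.

Lemma sat_emb (N : structure (sigMd S)) rho (phi : formula S) :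
  @sat _ N rho (emb phi) <-> @sat _ (reduct N) rho phi.
Proof.
elim: phi rho => [|t u|r a|p IHp q IHq|p IHp q IHq|p IHp q IHq|x p IHp|x p IHp] rho //=.
- by rewrite !eval_emb.
- suff -> : (fun i => @eval _ N rho (emb_term (a i))) =
      (fun i => @eval _ (reduct N) rho (a i)) by [].
  by apply: funext => i; exact: eval_emb.
- by rewrite IHp IHq.
- by rewrite IHp IHq.
- by rewrite IHp IHq.
- by split=> -[d Hd]; exists d; apply/IHp.
- by split=> H d; apply/IHp.
Qed.

Definition morley_model (N : structure (sigMd S)) :=
  forall (m : morley_idx S) rho, @sat _ N rho (morley_ax m).

Lemma morley_modelP (N : structure (sigMd S)) (m : morley_idx S) (rho : nat -> dom N) :
  morley_model N ->
  rint N (inr m : srel (sigMd S)) (fun i => rho (nat_of_ord i)) <->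
  @sat _ (reduct N) rho (proj1_sig m).1.
Proof.
by move=> /(_ m rho)[/= H1 H2]; rewrite -sat_emb; split.
Qed.

(** Each formula is equivalent to a relation symbol in both structures, and embeddings preserve and
    reflect relation symbols. *)
Lemma morley_elementary (N Q : structure (sigMd S)) (h : dom N -> dom Q) phi rho :
  morley_model N -> morley_model Q -> embedding h ->
  @sat _ N rho (emb phi) <-> @sat _ Q (h \o rho) (emb phi).
Proof.
move=> mN mQ [_ [_ rh]]; have [n bphi] := bnd_ex phi.
rewrite !sat_emb.
pose m : morley_idx S := exist _ (phi, n) bphi.
by rewrite -(morley_modelP m rho mN) -(morley_modelP m (h \o rho) mQ) rh.
Qed.

(** The symbol of a formula takes a finite tuple, while [sat] needs a full assignment. The free
    variables all lie within the tuple, so every extension of it to an assignment gives the same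
    truth value. *)
Definition expansion (N : structure S) (delta : dom N -> dom N) : structure (sigMd S) :=
  @Struct (sigMd S) (dom N)
    (fun f => match f return ('I_(sfar (sigMd S) f) -> dom N) -> dom N with
              | Some f => fint N f
              | None => fun a => delta (a ord0)
              end)
    (fun r => match r return ('I_(srar (sigMd S) r) -> dom N) -> Prop with
              | inl r => rint N r
              | inr m => fun a => exists rho : nat -> dom N,
                  (forall i, rho (nat_of_ord i) = a i) /\ sat rho (proj1_sig m).1
              end).

Lemma sat_expansion N delta rho phi :
  @sat _ (@expansion N delta) rho (emb phi) <-> @sat _ N rho phi.
Proof. by rewrite sat_emb; case: N delta rho. Qed.

Lemma morley_model_expansion N delta : morley_model (@expansion N delta).
Proof.
move=> m rho; split=> /=; rewrite sat_expansion => H; last by exists rho.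
have [rho' [E /sat_bnd]] := H; apply; first exact: (proj2_sig m).
by move=> k km; rewrite (E (Ordinal km)).
Qed.

(** The new relation symbols name arbitrary formulas, so [h] must be elementary on the reducts to
    respect them. The point [x0] pads a finite tuple to an assignment. *)
Lemma embedding_expansion (N : structure (sigMd S)) (K : structure S)
    (delta : dom K -> dom K) (h : dom N -> dom K) (x0 : dom N) :
  morley_model N -> @embedding _ (reduct N) K h ->
  (forall phi rho, @sat _ (reduct N) rho phi <-> @sat _ K (h \o rho) phi) ->
  (forall d, h (fint N (None : sfun (sigMd S)) (args1 d)) = delta (h d)) ->
  @embedding _ N (expansion delta) h.
Proof.
move=> mN [ih [fh rh]] elem dh; split=> //; split.
  case=> [f a|/= a]; first exact: fh.
  rewrite -dh; congr (h (fint N _ _)); apply: funext => i.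
  by rewrite /args1 (ord1 i).
case=> [r a|m a]; first exact: rh.
pose rho k := if insub k is Some i then a i else x0.
have rhoE (i : 'I_(srar (sigMd S) (inr m))) : rho (nat_of_ord i) = a i.
  by rewrite /rho valK.
have <- : (fun i => rho (nat_of_ord i)) = a by exact: funext.
rewrite (morley_modelP m rho mN) elem; split=> [H|[rho' [E H]]].
  by exists (h \o rho).
by apply: (proj1 (sat_bnd (proj2_sig m) _) H) => k km; rewrite (E (Ordinal km)).
Qed.

End Reduct.

(** * Models of [TMdelta] *)

Section GenericDerivations.
Variables (F0 : Type) (fa0 : F0 -> nat) (R0 : Type) (ra0 : R0 -> nat).
Variable T : theory (Lsig fa0 ra0).
Local Notation L' := (sigMd (Lsig fa0 ra0)).

Definition Mdelta (N : structure L') (x : dom N) : dom N :=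
  fint N (None : sfun L') (args1 x).

Definition derivation_in (K : structure (Lsig fa0 ra0)) (d : dom K -> dom K) :=
  (forall x y, d (Madd x y) = Madd (d x) (d y)) /\
  (forall x y, d (Mmul x y) = Madd (Mmul x (d y)) (Mmul y (d x))).

Lemma fun_args1 (A B : Type) (f : A -> B) (x : A) :
  (fun i => f (args1 x i)) = args1 (f x).
Proof. by []. Qed.

Lemma fun_args2 (A B : Type) (f : A -> B) (x y : A) :
  (fun i => f (args2 x y i)) = args2 (f x) (f y).
Proof. by apply: funext => i; rewrite /args2; case: ifP. Qed.

Lemma fun_args0 (A : Type) (a : 'I_0 -> A) : a = args0.
Proof. by apply: funext => -[]. Qed.

Section Terms.
Variables (N : structure L') (rho : nat -> dom N).

Lemma sat_Eqf t u : sat rho (Eqf t u) = (eval rho t = eval rho u).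
Proof. by []. Qed.

Lemma eval_tdelta t : eval rho (tdelta t) = Mdelta (eval rho t).
Proof. by rewrite /= fun_args1. Qed.

Lemma eval_tadd t u :
  eval rho (tadd t u) = @Madd _ _ _ _ (reduct N) (eval rho t) (eval rho u).
Proof. by rewrite /= (fun_args2 (eval rho)). Qed.

Lemma eval_tmul t u :
  eval rho (tmul t u) = @Mmul _ _ _ _ (reduct N) (eval rho t) (eval rho u).
Proof. by rewrite /= (fun_args2 (eval rho)). Qed.

End Terms.

Lemma models_TMdelta (N : structure L') :
  models (TMdelta T) N <->
  [/\ models T (reduct N), morley_model N & @derivation_in (reduct N) (@Mdelta N)].
Proof.
have daddE (rho : nat -> dom N) : sat rho (dax_add fa0 ra0) <->
    @Mdelta N (@Madd _ _ _ _ (reduct N) (rho 0) (rho 1)) =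
    @Madd _ _ _ _ (reduct N) (Mdelta (rho 0)) (Mdelta (rho 1)).
  by rewrite /dax_add sat_Eqf !(eval_tdelta, eval_tadd).
have dmulE (rho : nat -> dom N) : sat rho (dax_mul fa0 ra0) <->
    @Mdelta N (@Mmul _ _ _ _ (reduct N) (rho 0) (rho 1)) =
    @Madd _ _ _ _ (reduct N) (@Mmul _ _ _ _ (reduct N) (rho 0) (Mdelta (rho 1)))
      (@Mmul _ _ _ _ (reduct N) (rho 1) (Mdelta (rho 0))).
  by rewrite /dax_mul sat_Eqf !(eval_tdelta, eval_tadd, eval_tmul).
split=> [NT|[NT Nm [dadd dmul]] psi].
  split=> [phi Tphi rho|m rho|]; first 2 last.
  - split=> x y.
      by apply/(daddE (fun n => if n == 0 then x else y))/NT; right; right; left.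
    by apply/(dmulE (fun n => if n == 0 then x else y))/NT; right; right; right.
  - by apply/sat_emb/NT; left; exists phi.
  - by apply: NT; right; left; exists m.
case=> [[phi [Tphi ->]]|[[m ->]|[->|->]]] rho.
- by apply/sat_emb/NT.
- exact: Nm.
- by apply/daddE.
- by apply/dmulE.
Qed.

End GenericDerivations.


(** * Existence of existentially closed models *)

Section ExistentiallyClosed.
Variables (F0 : Type) (fa0 : F0 -> nat) (R0 : Type) (ra0 : R0 -> nat).
Variable T : theory (Lsig fa0 ra0).
Local Notation L' := (sigMd (Lsig fa0 ra0)).

Section Limit.
Variables (M : nat -> structure L') (h : forall n, dom (M n) -> dom (M n.+1)).
Hypotheses (MT : forall n, models (TMdelta T) (M n)) (hemb : forall n, embedding (@h n)).
Variable x0 : dom (M 0).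
Variables (U : set_system nat) (UU : UltraFilter U).
Hypothesis Uoo : forall n, U [set m | n <= m].

Let Lim := @chain_limit _ M h hemb x0 U UU Uoo.
Let lim n (d : dom (M n)) : dom Lim := to_limit hemb x0 UU Uoo d.

Lemma lim_upd n m (rho : nat -> dom (M n)) x (d : dom (M m)) : n <= m ->
  upd (@lim n \o rho) x (lim d) =
  @lim m \o upd (fun k => thread h x0 (rho k) m) x d.
Proof.
move=> nm; apply: funext => k; rewrite /upd /=; case: eqP => // _.
by rewrite /lim to_limit_later.
Qed.

(** The elementary chain argument. [morley_elementary] applies between stages but not to the limit,
    which is not yet known to satisfy the Morley axioms. In the quantifier cases an element of the
    limit comes from a later stage [m], and elementarity from stage [n] to stage [m] finishes. *)
Lemma limit_elementary phi n (rho : nat -> dom (M n)) :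
  sat rho (emb phi) <-> @sat _ Lim (@lim n \o rho) (emb phi).
Proof.
have mor k : morley_model (M k) by have /models_TMdelta[] := @MT k.
have elem n1 m (rho1 : nat -> dom (M n1)) psi : n1 <= m ->
    sat rho1 (emb psi) <-> sat (fun k => thread h x0 (rho1 k) m) (emb psi).
  by move=> nm; apply: (morley_elementary psi rho1 (mor n1) (mor m))
      (embedding_thread hemb x0 nm).
have step n1 (d : dom Lim) :
    exists m (d' : dom (M m)), n1 <= m /\ d = lim d'.
  have [m [d' ->]] := to_limit_surj d.
  exists (maxn n1 m), (thread h x0 d' (maxn n1 m)).
  by rewrite leq_maxl /lim to_limit_later // leq_maxr.
elim: phi n rho => [|t u|r a|p IHp q IHq|p IHp q IHq|p IHp q IHq|x p IHp|x p IHp] n rho.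
- by [].
- exact: (qf_embedding (embedding_to_limit hemb x0 UU Uoo n) rho
    (phi := emb (Eqf t u)) Logic.I).
- exact: (qf_embedding (embedding_to_limit hemb x0 UU Uoo n) rho
    (phi := emb (Relf r a)) Logic.I).
- by rewrite /= IHp IHq.
- by rewrite /= IHp IHq.
- by rewrite /= IHp IHq.
- split=> [[d Hd]|[d]] /=.
    by exists (lim d); rewrite -comp_upd -IHp.
  have [m [d' [nm ->]]] := step n d.
  rewrite (lim_upd rho x d' nm) => /IHp H.
  by apply/(elem _ _ _ (Exf x p) nm); exists d'.
- split=> [H d|H d] /=; last first.
    by apply/IHp; rewrite comp_upd; exact: H.
  have [m [d' [nm ->]]] := step n d.
  rewrite (lim_upd rho x d' nm); apply/IHp.
  by move/(elem _ _ _ (Allf x p) nm): H; exact.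
Qed.

Lemma models_chain_limit : models (TMdelta T) Lim.
Proof.
move=> psi Tpsi rho; have [k bpsi] := bnd_ex psi.
have [n [rho' E]] := to_limit_env rho k.
apply/(sat_bnd bpsi E); move: (MT Tpsi rho').
have lemb := embedding_to_limit hemb x0 UU Uoo n.
case: Tpsi => [[phi [_ ->]]|[[m ->]|[->|->]]].
- by move/limit_elementary.
- have R := qf_embedding lemb rho'
    (phi := @Relf L' (inr m) (fun i => Var (nat_of_ord i))) Logic.I.
  by case=> H1 H2; split=> [/R/H1/limit_elementary|/limit_elementary/H2/R].
- by move/(qf_embedding lemb); apply.
- by move/(qf_embedding lemb); apply.
Qed.

(** A formula has finitely many variables, so its parameters come from one stage [n]. Maximality of
    the step from [n] to [n.+1] makes it true at stage [n.+1], and existential formulas go up to the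
    limit. *)
Lemma ec_chain_limit :
  (forall n, max_extension (TMdelta T) (@h n)) -> ec_model (TMdelta T) Lim.
Proof.
move=> hmax; split; first exact: models_chain_limit.
move=> N g NT gemb phi rho ephi; have [k bphi] := bnd_ex phi.
have [n [rho' E]] := to_limit_env rho k.
have Eg j : j < k -> (g \o rho) j = (g \o @lim n.+1 \o @h n \o rho') j.
  by move=> /E /= ->; rewrite /lim to_limit_step.
move/(sat_bnd bphi Eg) => H.
apply/(sat_bnd bphi E).
have lemb := embedding_to_limit hemb x0 UU Uoo n.+1.
have := hmax n N (g \o @lim n.+1) NT (embedding_comp gemb lemb) phi rho' ephi H.
move/(existential_embedding lemb ephi).
suff -> : to_limit hemb x0 UU Uoo (n:=n.+1) \o (@h n \o rho') =
    (fun j => to_limit hemb x0 UU Uoo (rho' j)) by [].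
by apply: funext => j /=; rewrite to_limit_step.
Qed.

End Limit.

Lemma ec_model_ex (M : structure L') : models (TMdelta T) M ->
  (exists x0 : dom M, True) -> exists N, ec_model (TMdelta T) N.
Proof.
move=> MT [x0 _].
pose X := {N : structure L' | models (TMdelta T) N}.
have next (N : X) : {N' : X & {h : dom (sval N) -> dom (sval N') |
    embedding h /\ max_extension (TMdelta T) h}}.
  have /cid[N' /cid[h [N'T hemb hmax]]] := max_extension_ex (svalP N).
  by exists (exist _ N' N'T), h.
pose seqX := fix seqX n := if n is m.+1 then projT1 (next (seqX m))
  else exist _ M MT : X.
pose h n : dom (sval (seqX n)) -> dom (sval (seqX n.+1)) := sval (projT2 (next (seqX n))).
have hP n : embedding (@h n) /\ max_extension (TMdelta T) (@h n).
  exact: svalP (projT2 (next (seqX n))).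
have [||| U [UU Uoo]] := @directed_ultrafilter nat nat (fun n => [set m | n <= m]).
- by exists 0.
- move=> j k; exists (maxn j k) => m /=.
  by rewrite geq_max => /andP[].
- by move=> j; exists j => /=.
exists (chain_limit (fun n => (hP n).1) x0 UU Uoo).
apply: ec_chain_limit => [n|n]; first exact: svalP.
exact: (hP n).2.
Qed.

End ExistentiallyClosed.


(** * Extension of derivations *)

Import Order.TTheory GRing.Theory Num.Theory.
Local Open Scope ring_scope.

(* [quad e] is R[t]/(t^2 - e): the complex numbers over R for e = -1 and the
   dual numbers for e = 0. *)
Definition quad (R : comNzRingType) (e : R) : Type := (R * R)%type.

Section QuadRing.
Variables (R : comNzRingType) (e : R).
Local Notation Q := (quad e).

HB.instance Definition _ := GRing.Zmodule.copy Q (R * R)%type.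

Definition quad1 : Q := (1, 0).
Definition qmul (x y : Q) : Q :=
  (x.1 * y.1 + e * (x.2 * y.2), x.1 * y.2 + x.2 * y.1).

Lemma qmulA : associative qmul.
Proof. by move=> [a b] [c d] [f g]; congr pair => /=; ring. Qed.

Lemma qmulC : commutative qmul.
Proof. by move=> [a b] [c d]; congr pair => /=; ring. Qed.

Lemma qmul1 : left_id quad1 qmul.
Proof. by move=> [a b]; congr pair => /=; ring. Qed.

Lemma qmulDl : left_distributive qmul +%R.
Proof. by move=> [a b] [c d] [f g]; congr pair => /=; ring. Qed.

Lemma quad1_neq0 : quad1 != 0.
Proof. by apply/eqP => -[/eqP]; rewrite oner_eq0. Qed.

HB.instance Definition _ :=
  GRing.Zmodule_isComNzRing.Build Q qmulA qmulC qmul1 qmulDl quad1_neq0.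

Lemma quadP (x y : Q) : x.1 = y.1 -> x.2 = y.2 -> x = y.
Proof. by case: x y => a b [c d] /= -> ->. Qed.

Lemma qmulE (x y : Q) :
  x * y = (x.1 * y.1 + e * (x.2 * y.2), x.1 * y.2 + x.2 * y.1).
Proof. by []. Qed.

Lemma qaddE (x y : Q) : x + y = (x.1 + y.1, x.2 + y.2).
Proof. by []. Qed.

Lemma qoppE (x : Q) : - x = (- x.1, - x.2).
Proof. by []. Qed.

End QuadRing.

Local Notation dual L := (quad (0 : L)).

Section DualFst.
Variable L : comNzRingType.
Definition dual_fst (x : dual L) : L := x.1.

Lemma dual_fst_additive : zmod_morphism dual_fst.
Proof. by []. Qed.
Lemma dual_fst_multiplicative : monoid_morphism dual_fst.
Proof. by split=> // x y; rewrite /dual_fst /= mul0r addr0. Qed.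
HB.instance Definition _ :=
  GRing.isZmodMorphism.Build (dual L) L dual_fst dual_fst_additive.
HB.instance Definition _ :=
  GRing.isMonoidMorphism.Build (dual L) L dual_fst dual_fst_multiplicative.
Lemma dual_fstMn (x : dual L) n : dual_fst (x *+ n) = dual_fst x *+ n.
Proof. exact: raddfMn. Qed.
End DualFst.

Definition is_derivation (R : comNzRingType) (d : R -> R) :=
  (forall x y, d (x + y) = d x + d y) /\
  (forall x y, d (x * y) = x * d y + y * d x).

Section DerivationExtension.
Variable L : comNzRingType.
(** [L] is a field; this is spelled out because [cplx R], to which the section is applied, carries
    only a commutative ring structure. *)
Hypothesis Linv : forall x : L, x != 0 -> exists y, x * y = 1.
Hypothesis Lchar0 : forall n, n.+1%:R != 0 :> L.

Lemma mul_eq0l (x y : L) : x != 0 -> x * y = 0 -> y = 0.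
Proof.
move=> /Linv[z xz] xy.
by rewrite -[y]mul1r -xz -mulrA [z * y]mulrC mulrA xy mul0r.
Qed.

(* The graph of a derivation from a subring of [L] to [L]: [x |-> x + d(x) t] is
   then a ring morphism into the dual numbers. *)
Definition der_graph (G : set (dual L)) :=
  [/\ G 1, forall x y, G x -> G y -> G (x - y),
      forall x y, G x -> G y -> G (x * y) & forall s, G (0, s) -> s = 0].

Section Adjoin.
Variable G : set (dual L).
Hypothesis GG : der_graph G.

Let G1 : G 1. Proof. by case: GG. Qed.
Let GB x y : G x -> G y -> G (x - y). Proof. by case: GG => _ + _ _; apply. Qed.
Let GM x y : G x -> G y -> G (x * y). Proof. by case: GG => _ _ + _; apply. Qed.
Let Gfun s : G (0, s) -> s = 0. Proof. by case: GG => _ _ _; apply. Qed.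
Let G0 : G 0. Proof. by rewrite -(subrr 1); exact: GB. Qed.
Let GN x : G x -> G (- x). Proof. by move=> Gx; rewrite -sub0r; exact: GB. Qed.
Let GD x y : G x -> G y -> G (x + y).
Proof. by move=> Gx Gy; rewrite -[y]opprK; apply: GB => //; exact: GN. Qed.
Let Gfst x : G x -> dual_fst x = 0 -> x = 0.
Proof. by case: x => a s /= Gx a0; move: Gx; rewrite [a]a0 => /Gfun ->. Qed.

Let over (P : {poly dual L}) := forall i, G P`_i.

Lemma over_const c : G c -> over c%:P.
Proof. by move=> Gc i; rewrite coefC; case: ifP. Qed.

Lemma over_X : over 'X.
Proof. by move=> i; rewrite coefX; case: eqP. Qed.

Lemma over_sub P Q : over P -> over Q -> over (P - Q).
Proof. by move=> oP oQ i; rewrite coefB; exact: GB. Qed.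

Lemma over_mul P Q : over P -> over Q -> over (P * Q).
Proof.
move=> oP oQ i; rewrite coefM.
by apply: (@big_ind _ G) => [|x y|k _]; [exact: G0|exact: GD|exact: GM].
Qed.

Lemma over_exp P n : over P -> over (P ^+ n).
Proof.
move=> oP; elim: n => [|n IH]; first by rewrite expr0 -polyC1; exact: over_const.
by rewrite exprS; exact: over_mul.
Qed.

Lemma over_deriv P : over P -> over P^`().
Proof.
move=> oP i; rewrite coef_deriv; move: (oP i.+1); move: (P`_i.+1) => c Gc.
by elim: i.+1 => [|n IH]; [rewrite mulr0n; exact: G0|rewrite mulrS; exact: GD].
Qed.

Lemma over_fst0 P : over P -> map_poly (@dual_fst L) P = 0 -> P = 0.
Proof.
move=> oP P0; apply/polyP => i; rewrite coef0; apply: Gfst => //.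
by rewrite -coef_map P0 coef0.
Qed.

(** Taylor expansion at [z], which stops at first order because the increment [(0, w)] has square
    zero. *)
Lemma horner_dual (P : {poly dual L}) (z w : L) :
  P.[((z, w) : dual L)] = P.[((z, 0) : dual L)] + P^`().[((z, 0) : dual L)] * (0, w).
Proof.
elim/poly_ind: P => [|P c IH]; first by rewrite deriv0 !horner0 mul0r addr0.
rewrite derivMXaddC !hornerMXaddC hornerD hornerMX IH.
have -> : ((z, w) : dual L) = (z, 0) + (0, w).
  by apply: quadP; rewrite qaddE /= ?addr0 ?add0r.
have w2 : ((0, w) : dual L) * (0, w) = 0.
  by apply: quadP; rewrite qmulE /= !(mul0r, mulr0, addr0).
have aux (A : comNzRingType) (a b d x y : A) : y * y = 0 ->
    (a + b * y) * (x + y) + d = a * x + d + (a + b * x) * y.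
  move=> yy; transitivity (a * x + d + (a + b * x) * y + b * (y * y)); first by ring.
  by rewrite yy mulr0 addr0.
exact: aux.
Qed.

(* If [z] is transcendental over the domain, any [w] works; otherwise the minimal
   polynomial P of [z] forces [w = - P^d(z) / P'(z)], where P^d has the derived
   coefficients. *)
Lemma adjoin_functional (z : L) : exists w : L, forall Q, over Q ->
  (map_poly (@dual_fst L) Q).[z] = 0 -> Q.[((z, w) : dual L)] = 0.
Proof.
pose alg n := `[< exists P, [/\ over P, size P = n,
  map_poly (@dual_fst L) P != 0 & (map_poly (@dual_fst L) P).[z] = 0] >].
have [exalg|noalg] := pselect (exists n, alg n); last first.
  exists 0 => Q oQ Qz; rewrite (over_fst0 oQ) ?horner0 //.
  apply: contrapT => /eqP nQ; apply: noalg; exists (size Q); apply/asboolP.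
  by exists Q.
case: (ex_minnP exalg) => n /asboolP[P [oP sP P0 Pz]] minP.
have small Q : over Q -> (map_poly (@dual_fst L) Q).[z] = 0 ->
    (size Q < n)%N -> Q = 0.
  move=> oQ Qz sQ; apply: (over_fst0 oQ); apply: contrapT => /eqP nQ.
  have : alg (size Q) by apply/asboolP; exists Q.
  by move/minP; rewrite leqNgt sQ.
have PN0 : P != 0 by apply: contraNneq P0 => ->; rewrite rmorph0.
(* The derivative has smaller size, so by minimality it could vanish at [z] only by being zero; in
   characteristic 0 the projection of [P] would then be a constant with a root, hence zero. *)
have P'z : (map_poly (@dual_fst L) P^`()).[z] != 0.
  apply/eqP => /(small _ (over_deriv oP)) P'0.
  have {}P'0 : P^`() = 0.
    by apply: P'0; rewrite -sP; exact: lt_size_deriv.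
  have Pc i : (map_poly (@dual_fst L) P)`_i.+1 = 0.
    have : dual_fst (P`_i.+1 *+ i.+1) = 0 by rewrite -coef_deriv P'0 coef0.
    by rewrite dual_fstMn -mulr_natl coef_map; apply: mul_eq0l; exact: Lchar0.
  move: Pz P0; have -> : map_poly (@dual_fst L) P = ((map_poly (@dual_fst L) P)`_0)%:P.
    by apply/polyP => -[|i]; rewrite coefC //= Pc.
  by rewrite hornerC => ->; rewrite eqxx.
have [y Py] := Linv P'z.
pose w := - (P.[((z, 0) : dual L)]).2 * y.
have Pzw : P.[((z, w) : dual L)] = 0.
  have fstE (R : {poly dual L}) : (R.[((z, 0) : dual L)]).1 = (map_poly (@dual_fst L) R).[z].
    by rewrite -[RHS]/((map_poly (@dual_fst L) R).[dual_fst ((z, 0) : dual L)]) horner_map.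
  rewrite horner_dual; apply: quadP => /=.
    by rewrite fstE Pz; ring.
  rewrite fstE /w mulr0 addr0.
  transitivity ((P.[((z, 0) : dual L)]).2 - (P.[((z, 0) : dual L)]).2 *
    ((map_poly (@dual_fst L) P^`()).[z] * y)); first by ring.
  by rewrite Py mulr1 subrr.
exists w => Q; have [m] := ubnP (size Q).
elim: m Q => // m IH Q; rewrite ltnS => sQ oQ Qz.
have [sQn|nsQ] := ltnP (size Q) n; first by rewrite (small Q) // horner0.
(* Pseudo-division: [G] is only a ring, so [Q] is multiplied by the leading coefficient of [P]
   instead of dividing by it. At the end [c] cancels because its first component is nonzero. *)
pose c := lead_coef P; pose k := (size Q - n)%N.
pose Q1 := c%:P * Q - (lead_coef Q)%:P * 'X^k * P.
have oc : G c by exact: oP.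
have oQ1 : over Q1.
  apply: over_sub; apply: over_mul => //; first exact: over_const.
  apply: over_mul; first by apply: over_const; exact: oQ.
  by apply: over_exp; exact: over_X.
have n0 : (0 < n)%N by rewrite -sP size_poly_gt0.
have Q0 : (0 < size Q)%N by exact: leq_trans n0 nsQ.
have sQ1 : (size Q1 < size Q)%N.
  rewrite -[X in (_ < X)%N](prednK Q0) ltnS; apply/leq_sizeP => i iQ.
  rewrite coefB coefCM -mulrA coefCM coefXnM.
  have ik : (i < k)%N = false.
    by apply/negbTE; rewrite -leqNgt; apply: leq_trans iQ; rewrite /k -ltnS prednK // ltn_subrL n0.
  rewrite ik; move: iQ; rewrite leq_eqVlt => /orP[/eqP <-|iQ].
    have -> : ((size Q).-1 - k)%N = n.-1 by rewrite /k; lia.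
    by rewrite /c /lead_coef sP mulrC subrr.
  rewrite [Q`_i]nth_default; last by rewrite -(prednK Q0).
  rewrite nth_default ?mulr0 ?subrr // sP /k; lia.
have evE (R : {poly dual L}) : (R.[((z, w) : dual L)]).1 = (map_poly (@dual_fst L) R).[z].
  by rewrite -[RHS]/((map_poly (@dual_fst L) R).[dual_fst ((z, w) : dual L)]) horner_map.
have Q1E : Q1.[((z, w) : dual L)] = c * Q.[((z, w) : dual L)].
  by rewrite /Q1 hornerD hornerN !hornerM hornerC Pzw mulr0 subr0.
have cQ : c * Q.[((z, w) : dual L)] = 0.
  rewrite -Q1E; apply: IH => //; first exact: leq_trans sQ1 sQ.
  by rewrite -evE Q1E /= evE Qz mulr0 add0r mul0r.
have c0 : c.1 != 0.
  apply/eqP => /(Gfst oc)/eqP; apply/negP.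
  by rewrite lead_coef_eq0.
have Q1z : (Q.[((z, w) : dual L)]).1 = 0 by rewrite evE Qz.
move: cQ; case: (Q.[_]) Q1z => a s /= -> [_ /eqP].
by rewrite mulr0 addr0 => /eqP/(mul_eq0l c0) ->.
Qed.

Lemma der_graph_adjoin (z : L) : exists (w : L) (G' : set (dual L)),
  [/\ der_graph G', G `<=` G' & G' (z, w)].
Proof.
have [w Hw] := adjoin_functional z.
exists w, [set x | exists2 P, over P & x = P.[((z, w) : dual L)]]; split.
- split.
  + by exists 1; [exact: over_const|rewrite hornerC].
  + move=> _ _ [P oP ->] [Q oQ ->]; exists (P - Q); first exact: over_sub.
    by rewrite hornerD hornerN.
  + move=> _ _ [P oP ->] [Q oQ ->]; exists (P * Q); first exact: over_mul.
    by rewrite hornerM.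
  + move=> s [P oP Ps]; suff : P.[((z, w) : dual L)] = 0 by rewrite -Ps => -[].
    apply: Hw => //.
    rewrite -[LHS]/((map_poly (@dual_fst L) P).[dual_fst ((z, w) : dual L)]).
    by rewrite horner_map -Ps.
- by move=> x Gx; exists x%:P; [exact: over_const|rewrite hornerC].
- by exists 'X; [exact: over_X|rewrite hornerX].
Qed.

End Adjoin.

(** A maximal graph is total, since [der_graph_adjoin] enlarges it to cover any given point. *)
Lemma derivation_extends (G : set (dual L)) : der_graph G ->
  exists D : L -> L, is_derivation D /\ forall x, G x -> D x.1 = x.2.
Proof.
move=> GG.
(* Zorn runs over the sets whose union with [G] is a graph; this way the empty chain is bounded by
   [G] itself. *)
pose P (A : set (dual L)) := der_graph (G `|` A).
have [|A [PA maxA]] := @Zorn_bigcup _ P.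
  move=> F FP Ftot.
  have two x y : (G `|` \bigcup_(A in F) A) x -> (G `|` \bigcup_(A in F) A) y ->
      G x /\ G y \/ exists A, [/\ F A, (G `|` A) x & (G `|` A) y].
    move=> [Gx|[A FA Ax]] [Gy|[B FB By]]; first by left.
    - by right; exists B; split=> //; [left|right].
    - by right; exists A; split=> //; [right|left].
    - right; have [AB|BA] := Ftot _ _ FA FB.
        by exists B; split=> //; right => //; exact: AB.
      by exists A; split=> //; right => //; exact: BA.
  have up A x : F A -> (G `|` A) x -> (G `|` \bigcup_(A in F) A) x.
    by move=> FA [Gx|Ax]; [left|right; exists A].
  have [g1 gB gM gf] := GG.
  split; first by left.
  + move=> x y Hx Hy; have [[Gx Gy]|[A [FA Ax Ay]]] := two x y Hx Hy.
      by left; exact: gB.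
    by apply: (up A) => //; have [_ + _ _] := FP _ FA; apply.
  + move=> x y Hx Hy; have [[Gx Gy]|[A [FA Ax Ay]]] := two x y Hx Hy.
      by left; exact: gM.
    by apply: (up A) => //; have [_ _ + _] := FP _ FA; apply.
  + move=> s [Gs|[A FA As]]; first exact: gf.
    by have [_ _ _] := FP _ FA; apply; right.
have dom z : exists w, (G `|` A) (z, w).
  have [w [G' [GG' sub Gzw]]] := der_graph_adjoin PA z.
  apply: contrapT => nz; apply: (maxA G').
    split; first by move=> x Ax; apply: sub; right.
    by move=> /(_ _ Gzw) Azw; apply: nz; exists w; right.
  suff GG'E : G `|` G' = G' by rewrite /P GG'E.
  by apply/seteqP; split=> x; [case=> // Gx; apply: sub; left|right].
have [D HD] := choice dom.
have [g1 gB gM gf] := PA.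
have Dval a d : (G `|` A) (a, d) -> D a = d.
  move=> Gad; apply/eqP; rewrite -subr_eq0; apply/eqP/gf.
  suff <- : ((a, D a) : dual L) - (a, d) = (0, D a - d) by exact: gB.
  by apply: quadP; rewrite qaddE qoppE //= subrr.
exists D; split; last by move=> [a d] Gad; apply: Dval; left.
split=> x y; apply: Dval.
- have g0 : (G `|` A) 0 by rewrite -(subrr (1 : dual L)); exact: gB.
  suff <- : ((x, D x) : dual L) - (0 - (y, D y)) = (x + y, D x + D y).
    exact: gB (HD x) (gB _ _ g0 (HD y)).
  by rewrite sub0r opprK.
- suff <- : ((x, D x) : dual L) * (y, D y) = (x * y, x * D y + y * D x) by exact: gM.
  by apply: quadP; rewrite qmulE /=; ring.
Qed.

End DerivationExtension.


(** * The field K + iK and its derivations *)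

Local Notation cplx R := (quad (-1 : R)).

Section ComplexField.
Variable R : realFieldType.

Lemma cplx_inv (z : cplx R) : z != 0 -> exists w, z * w = 1.
Proof.
case: z => a b z0; have n0 : a ^+ 2 + b ^+ 2 != 0.
  apply: contraNneq z0 => /eqP; rewrite paddr_eq0 ?sqr_ge0 // !sqrf_eq0.
  by case/andP => /eqP -> /eqP ->.
exists (a / (a ^+ 2 + b ^+ 2), - b / (a ^+ 2 + b ^+ 2)).
by apply: quadP; rewrite qmulE /=; field.
Qed.

Lemma cplx_natr1 n : (n%:R : cplx R).1 = n%:R.
Proof. by elim: n => // n IH; rewrite !mulrS -IH. Qed.

Lemma cplx_char0 n : n.+1%:R != 0 :> cplx R.
Proof.
apply/eqP => /(congr1 fst)/eqP; rewrite cplx_natr1; apply/negP.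
by rewrite (pnatr_eq0 R).
Qed.

End ComplexField.

Section CplxMap.
Variables (R S : comNzRingType) (f : {rmorphism R -> S}).
Definition cplx_map (x : cplx R) : cplx S := (f x.1, f x.2).

Lemma cplx_map_additive : zmod_morphism cplx_map.
Proof.
by move=> x y; apply: quadP; rewrite /cplx_map !(qaddE, qoppE) /= rmorphB.
Qed.
Lemma cplx_map_multiplicative : monoid_morphism cplx_map.
Proof.
split=> [|x y]; first by apply: quadP; rewrite /= ?rmorph1 ?rmorph0.
by apply: quadP; rewrite /= rmorphD !rmorphM ?rmorphN1.
Qed.
HB.instance Definition _ :=
  GRing.isZmodMorphism.Build (cplx R) (cplx S) cplx_map cplx_map_additive.
HB.instance Definition _ :=
  GRing.isMonoidMorphism.Build (cplx R) (cplx S) cplx_map cplx_map_multiplicative.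
End CplxMap.

Section DerivationTheory.
Variables (A : comNzRingType) (d : A -> A).
Hypothesis dD : is_derivation d.

Lemma der0 : d 0 = 0.
Proof. by apply: (addIr (d 0)); rewrite -dD.1 !add0r. Qed.

Lemma derN x : d (- x) = - d x.
Proof. by apply/eqP; rewrite -addr_eq0 -dD.1 addNr der0. Qed.

Lemma der1 : d 1 = 0.
Proof. by apply: (addIr (d 1)); rewrite add0r -{3}[1]mulr1 dD.2 !mul1r. Qed.

Lemma derX x n : x * d (x ^+ n) = n%:R * x ^+ n * d x.
Proof.
elim: n => [|n IH]; first by rewrite expr0 der1 mulr0 !mul0r.
rewrite exprS dD.2 mulrDr IH mulrA -natr1.
by ring.
Qed.

End DerivationTheory.

Section Tangent.
Variables (A B : comNzRingType) (j : {rmorphism A -> B}) (d : A -> A).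

(** The derivation as the ring morphism sending a to j(a) + j(d a) t. The proof [dD] is an argument
    so that the morphism instances can be attached to the function. *)
Definition tangent (dD : is_derivation d) (a : A) : dual B := (j a, j (d a)).

Variable dD : is_derivation d.
Lemma tangent_additive : zmod_morphism (tangent dD).
Proof.
move=> x y; apply: quadP; rewrite !(qaddE, qoppE) /= ?rmorphB //.
by rewrite dD.1 (derN dD) rmorphB.
Qed.
Lemma tangent_multiplicative : monoid_morphism (tangent dD).
Proof.
split=> [|x y]; first by apply: quadP; rewrite /= ?rmorph1 ?(der1 dD) ?rmorph0.
apply: quadP; rewrite qmulE /= ?rmorphM; first by ring.
by rewrite dD.2 rmorphD !rmorphM; ring.
Qed.
HB.instance Definition _ :=
  GRing.isZmodMorphism.Build A (dual B) (tangent dD) tangent_additive.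
HB.instance Definition _ :=
  GRing.isMonoidMorphism.Build A (dual B) (tangent dD) tangent_multiplicative.
End Tangent.

(* The outer variable takes the value [v], the inner one [u]. *)
Definition horner2 (A : comNzRingType) (P : {poly {poly A}}) (u v : A) : A :=
  P.[v%:P].[u].

Lemma horner2_map (A B : comNzRingType) (f : {rmorphism A -> B})
    (P : {poly {poly A}}) u v :
  horner2 (map_poly (map_poly f) P) (f u) (f v) = f (horner2 P u v).
Proof. by rewrite /horner2 -map_polyC !horner_map. Qed.

Section DerivationOfIndependent.
Variables (A L : comNzRingType) (j : {rmorphism A -> L}) (d : A -> A) (u v : L).
Hypothesis Linv : forall x : L, x != 0 -> exists y, x * y = 1.
Hypothesis Lchar0 : forall n, n.+1%:R != 0 :> L.
Hypothesis dD : is_derivation d.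
Hypothesis indep : forall P : {poly {poly A}}, P != 0 ->
  horner2 (map_poly (map_poly j) P) u v != 0.

(** Polynomials in u, v are evaluated at the dual numbers u and v + t, with [d] acting on the
    coefficients. By independence a value with first component 0 comes only from the zero
    polynomial, so the values form a graph. *)
Lemma derivation_of_independent : exists D : L -> L,
  [/\ is_derivation D, forall a, D (j a) = j (d a), D u = 0 & D v = 1].
Proof.
pose Phi (P : {poly {poly A}}) : dual L :=
  horner2 (map_poly (map_poly (tangent j dD)) P) (u, 0) (v, 1).
have Phi1 P : dual_fst (Phi P) = horner2 (map_poly (map_poly j) P) u v.
  rewrite -horner2_map -map_poly_comp; congr (horner2 _ _ _).
  by apply: eq_map_poly => Q /=; rewrite -map_poly_comp; apply: eq_map_poly.
have PhiB P Q : Phi (P - Q) = Phi P - Phi Q.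
  by rewrite /Phi /horner2 rmorphB /= !hornerD !hornerN.
have PhiM P Q : Phi (P * Q) = Phi P * Phi Q.
  by rewrite /Phi /horner2 rmorphM /= !hornerM.
have PhiC a : Phi a%:P%:P = tangent j dD a.
  by rewrite /Phi /horner2 !map_polyC /= map_polyC !hornerC.
have Phi0 : Phi 0 = 0 by rewrite /Phi /horner2 rmorph0 !horner0.
have [|D [DD HD]] := derivation_extends Linv Lchar0 (G := range Phi).
  split.
  - exists 1 => //; rewrite -[1 in LHS]/(1%:P%:P) PhiC.
    exact: (rmorph1 (tangent j dD)).
  - by move=> _ _ [P _ <-] [Q _ <-]; exists (P - Q).
  - by move=> _ _ [P _ <-] [Q _ <-]; exists (P * Q).
  - move=> s [P _ Ps]; have [P0|/indep] := eqVneq P 0.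
      by move: Ps; rewrite P0 Phi0 => -[].
    by rewrite -Phi1 Ps eqxx.
exists D; split=> //.
- by move=> a; apply: (HD (tangent j dD a)); exists a%:P%:P.
- apply: (HD (u, 0)); exists 'X%:P => //.
  by rewrite /Phi /horner2 map_polyC /= map_polyX hornerC hornerX.
- apply: (HD (v, 1)); exists 'X => //.
  by rewrite /Phi /horner2 map_polyX hornerX hornerC.
Qed.

End DerivationOfIndependent.

Definition cplx_der (R : comNzRingType) (d : R -> R) (z : cplx R) : cplx R :=
  (d z.1, d z.2).

Lemma cplx_derP (R : comNzRingType) (d : R -> R) :
  is_derivation d -> is_derivation (cplx_der d).
Proof.
move=> dD; split=> x y; apply: quadP => /=.
- by rewrite dD.1.
- by rewrite dD.1.
- rewrite dD.1 mulN1r (derN dD) !dD.2; ring.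
- by rewrite dD.1 !dD.2; ring.
Qed.

Section ComplexDerivation.
Variables (R : realFieldType) (D : cplx R -> cplx R).
Hypothesis DD : is_derivation D.

(** [D] need not map the real axis to itself, but the two coordinates of its restriction to it are
    derivations of [R]; as D(i) = 0, they determine [D]. *)
Definition re_der (x : R) : R := (D (x, 0)).1.
Definition im_der (x : R) : R := (D (x, 0)).2.

Let DDr (x y : R) : D (x + y, 0) = D (x, 0) + D (y, 0).
Proof. by rewrite -DD.1; congr D; apply: quadP; rewrite qaddE //= addr0. Qed.
Let DMr (x y : R) : D (x * y, 0) =
  ((x, 0) : cplx R) * D (y, 0) + ((y, 0) : cplx R) * D (x, 0) :> cplx R.
Proof. by rewrite -DD.2; congr D; apply: quadP; rewrite qmulE /=; ring. Qed.

Lemma re_derP : is_derivation re_der.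
Proof.
split=> x y; rewrite /re_der ?DDr ?DMr //.
by rewrite !qmulE qaddE /=; ring.
Qed.

Lemma im_derP : is_derivation im_der.
Proof.
split=> x y; rewrite /im_der ?DDr ?DMr //.
by rewrite !qmulE qaddE /=; ring.
Qed.

Lemma der_i : D (0, 1) = 0.
Proof.
have : D (((0, 1) : cplx R) * (0, 1)) = 0.
  have -> : ((0, 1) : cplx R) * (0, 1) = - 1 by apply: quadP; rewrite qmulE /=; ring.
  by rewrite (derN DD) (der1 DD) oppr0.
rewrite DD.2; case: (D (0, 1)) => p q.
rewrite !qmulE qaddE /= => -[/eqP E1 /eqP E2].
by apply: quadP => /=; [move/eqP: E2|move/eqP: E1]; lra.
Qed.

Lemma complex_derE (z : cplx R) :
  D z = cplx_der re_der z + ((0, 1) : cplx R) * cplx_der im_der z.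
Proof.
case: z => a b.
transitivity (D (((a, 0) : cplx R) + ((0, 1) : cplx R) * (b, 0))).
  by congr D; apply: quadP; rewrite qaddE qmulE /=; ring.
rewrite DD.1 DD.2 der_i mulr0 addr0.
by apply: quadP; rewrite !(qaddE, qmulE) /= /re_der /im_der; ring.
Qed.

End ComplexDerivation.

(** Take [D] with D(u) = 0 and D(v) = 1. On the image of [h] its imaginary part vanishes, so both
    [re_der D] and [re_der D + im_der D] extend [d]. If both obeyed the rule, then by linearity so
    would [im_der D], and hence [D], giving u = 0. *)
Lemma log_derivative_violation (K R : realFieldType) (h : {rmorphism K -> R})
    (d : K -> K) (b : K) (u v : cplx R) :
  is_derivation d -> u != 0 ->
  (forall P : {poly {poly cplx K}}, P != 0 ->
     horner2 (map_poly (map_poly (cplx_map h)) P) u v != 0) ->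
  exists d' : R -> R, [/\ is_derivation d', forall a, d' (h a) = h (d a) &
    u * cplx_der d' v <> ((h b, 0) : cplx R) * v * cplx_der d' u].
Proof.
move=> dD u0 indep.
have [D [DD Dj Du Dv]] :=
  derivation_of_independent (@cplx_inv R) (@cplx_char0 R) (cplx_derP dD) indep.
have Dh a : D (h a, 0) = (h (d a), 0).
  have h0 x : cplx_map h (x, 0) = (h x, 0) by rewrite /cplx_map /= rmorph0.
  by rewrite -h0 Dj /cplx_der /= (der0 dD) h0.
have [reP imP] := (re_derP DD, im_derP DD).
have sumP : is_derivation (fun x => re_der D x + im_der D x).
  by split=> x y; rewrite ?reP.1 ?imP.1 ?reP.2 ?imP.2; ring.
apply: contrapT => nex.
have re_eq : u * cplx_der (re_der D) v = ((h b, 0) : cplx R) * v * cplx_der (re_der D) u.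
  apply: contrapT => ne; apply: nex; exists (re_der D); split=> // a.
  by rewrite /re_der Dh.
have sum_eq : u * cplx_der (fun x => re_der D x + im_der D x) v =
    ((h b, 0) : cplx R) * v * cplx_der (fun x => re_der D x + im_der D x) u.
  apply: contrapT => ne; apply: nex.
  exists (fun x => re_der D x + im_der D x); split=> // a.
  by rewrite /re_der /im_der Dh /= addr0.
have sumE z : cplx_der (fun x => re_der D x + im_der D x) z =
    cplx_der (re_der D) z + cplx_der (im_der D) z by [].
have im_eq : u * cplx_der (im_der D) v = ((h b, 0) : cplx R) * v * cplx_der (im_der D) u.
  by move: sum_eq; rewrite !sumE !mulrDr re_eq => /addrI.
have : u * D v = ((h b, 0) : cplx R) * v * D u.
  rewrite !(complex_derE DD) !mulrDr re_eq; congr (_ + _).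
  by rewrite mulrCA im_eq mulrCA.
by rewrite Dv Du mulr1 mulr0 => /eqP; apply/negP.
Qed.


(** * Independence of characters *)

(** Shifting the relation by [y] and subtracting [chi l y] times the original removes [l]; a [y]
    that separates [k] from [l] keeps the coefficient of [k] alive. Only closure of [I] under
    addition is used, no inverses. *)
Lemma artin_independence (X : zmodType) (I : set X) (L : comNzRingType)
    (J : eqType) (chi : J -> X -> L) (s : seq J) (c : J -> L) :
  (forall x : L, x != 0 -> exists y, x * y = 1) ->
  (forall x y, I x -> I y -> I (x + y)) ->
  (forall k x y, I x -> I y -> chi k (x + y) = chi k x * chi k y) ->
  (forall k, exists2 x, I x & chi k x != 0) ->
  (forall k l, k != l -> exists2 x, I x & chi k x != chi l x) ->
  uniq s -> (forall x, I x -> \sum_(k <- s) c k * chi k x = 0) ->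
  forall k, k \in s -> c k = 0.
Proof.
move=> Linv ID chiD chi0 chiN; elim: s c => // l s IH c /= /andP[ls us] H.
have cs k : k \in s -> c k = 0.
  move=> ks; have lk : k != l by apply: contraNneq ls => <-.
  have [y Iy kly] := chiN k l lk.
  have : c k * (chi k y - chi l y) = 0.
    apply: (IH (fun k => c k * (chi k y - chi l y))) => // x Ix.
    have := H _ (ID _ _ Ix Iy); have := H _ Ix; rewrite !big_cons => H1 H2.
    transitivity (\sum_(j <- s) c j * chi j (x + y) - chi l y * \sum_(j <- s) c j * chi j x).
      rewrite mulr_sumr -sumrB; apply: eq_bigr => j _.
      by rewrite chiD //; ring.
    have -> : \sum_(j <- s) c j * chi j (x + y) = - (c l * chi l (x + y)).
      by apply/eqP; rewrite -addr_eq0 addrC H2.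
    have -> : \sum_(j <- s) c j * chi j x = - (c l * chi l x).
      by apply/eqP; rewrite -addr_eq0 addrC H1.
    by rewrite chiD //; ring.
  by rewrite mulrC; apply: mul_eq0l => //; rewrite subr_eq0.
move=> k; rewrite inE => /orP[/eqP ->|/cs //].
have [x Ix chix] := chi0 l; have := H _ Ix.
rewrite big_cons big_seq big1 ?addr0; last by move=> j /cs ->; rewrite mul0r.
by rewrite mulrC; apply: mul_eq0l.
Qed.

Lemma horner2E (A : comNzRingType) (P : {poly {poly A}}) (u v : A) (m : nat) :
  (forall i, (size (P`_i)%R <= m)%N) ->
  horner2 P u v =
  \sum_(k : 'I_(size P) * 'I_m) (P`_k.1)`_k.2 * (u ^+ k.2 * v ^+ k.1).
Proof.
move=> sP; rewrite /horner2 (horner_coef P) horner_sum.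
rewrite -(pair_big xpredT xpredT (fun (i : 'I_(size P)) (l : 'I_m) =>
   (P`_i)`_l * (u ^+ l * v ^+ i))) /=.
apply: eq_bigr => i _; rewrite hornerM horner_exp hornerC.
rewrite (horner_coef_wide _ (sP i)) mulr_suml.
by apply: eq_bigr => l _; rewrite mulrA.
Qed.

Section SineIndependence.
Variables (K : realFieldType) (F : K -> cplx K) (p b y : K).
Hypothesis p0 : 0 < p.
Hypothesis FD : forall x x' : K, 0 <= x -> 0 <= x' -> x + x' < p ->
  F (x + x') = F x * F x'.
Hypothesis F0 : forall x : K, 0 <= x -> x < p -> F x != 0.
Hypothesis binf : forall n : nat, n%:R <= b.
(** The factor [b] ensures that (i + jb)x < p for all natural i, j, so that [FD] applies to all sums
    of such terms. *)
Definition small (x : K) := 0 <= x /\ forall n : nat, n%:R * b * x < p.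
Hypothesis smally : small y.
Hypothesis Fy : F y != 1.

Lemma sine_at0 : F 0 = 1.
Proof.
have F00 : F 0 * F 0 = F 0 by rewrite -FD ?addr0.
have [z zF] := cplx_inv (F0 (lexx 0) p0).
by rewrite -zF -[in RHS]F00 -mulrA zF mulr1.
Qed.

Lemma sine_mulrn (x : K) n : 0 <= x -> n%:R * x < p -> F (n%:R * x) = F x ^+ n.
Proof.
move=> x0; elim: n => [|n IH]; first by rewrite mul0r sine_at0.
rewrite -natr1 mulrDl mul1r => nx.
have nx0 : 0 <= n%:R * x by rewrite mulr_ge0.
by rewrite FD // IH ?exprSr //; lra.
Qed.

Let b1 : 1 <= b. Proof. exact: binf 1. Qed.

Let b0 : 0 <= b. Proof. exact: binf 0. Qed.

Lemma smallD (x x' : K) : small x -> small x' -> small (x + x').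
Proof.
move=> [x0 hx] [x'0 hx']; split=> [|n]; first exact: addr_ge0.
(* Each summand is tested at 2n, so that the two halves add up to a bound by [p]. *)
have E z : (2 * n)%:R * b * z = 2 * (n%:R * b * z) by rewrite natrM !mulrA.
by have := hx (2 * n)%N; have := hx' (2 * n)%N; rewrite !E mulrDr; lra.
Qed.

Lemma small_le (x x' : K) : 0 <= x -> x <= x' -> small x' -> small x.
Proof.
move=> x0 xx' [x'0 hx']; split=> // n; apply: le_lt_trans (hx' n).
by rewrite ler_wpM2l // mulr_ge0.
Qed.

Lemma small0 : small 0.
Proof. by split=> // n; rewrite mulr0. Qed.

Lemma small_lt (x : K) (n m : nat) : small x -> (n%:R + m%:R * b) * x < p.
Proof.
move=> [x0 hx]; apply: le_lt_trans (hx (n + m)%N); rewrite ler_wpM2r //.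
by rewrite natrD mulrDl lerD2r ler_peMr.
Qed.

(** The exponents follow the degrees in [horner2]: [k.1] is the outer one, belonging to F(bx), and
    [k.2] the inner one. *)
Definition sine_char (k : nat * nat) (x : K) := F x ^+ k.2 * F (b * x) ^+ k.1.

Lemma sine_charE k (x : K) : small x -> sine_char k x = F ((k.2%:R + k.1%:R * b) * x).
Proof.
move=> sx; have [x0 hx] := sx; rewrite mulrDl.
have h1 := small_lt k.2 0 sx; have h2 := small_lt 0 k.1 sx.
have h3 := small_lt k.2 k.1 sx.
rewrite FD.
- by rewrite -mulrA !sine_mulrn //; [rewrite mulr_ge0 //; lra|lra|lra].
- by rewrite mulr_ge0.
- by rewrite !mulr_ge0 //; lra.
- by rewrite -mulrDl.
Qed.

Lemma sine_charD k (x x' : K) : small x -> small x' ->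
  sine_char k (x + x') = sine_char k x * sine_char k x'.
Proof.
move=> sx sx'; have sxx' := smallD sx sx'; rewrite !sine_charE // mulrDr FD //.
- by rewrite mulr_ge0 ?sx.1 // addr_ge0 // mulr_ge0 //; lra.
- by rewrite mulr_ge0 ?sx'.1 // addr_ge0 // mulr_ge0 //; lra.
- by rewrite -mulrDr; exact: small_lt.
Qed.

(** As [b] exceeds every natural number, the values j + ib are ordered lexicographically by (i, j).
    The gap of at least 1 lets division by a difference of two of them preserve smallness. *)
Lemma infinite_gap (k l : nat * nat) : k != l ->
  let q (k : nat * nat) := k.2%:R + k.1%:R * b in
  q l + 1 <= q k \/ q k + 1 <= q l.
Proof.
have gap (i j i' j' : nat) : (i < i')%N -> j%:R + i%:R * b + 1 <= j'%:R + i'%:R * b.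
  move=> ii'; have jb := binf j.+1.
  have : i.+1%:R * b <= i'%:R * b by rewrite ler_wpM2r ?ler_nat //; lra.
  have := ler0n K j'; rewrite -natr1 in jb; rewrite -natr1 mulrDl mul1r; lra.
case: k l => i j [i' j'] /=; rewrite xpair_eqE negb_and => ne.
have [ii'|i'i|ii'] := ltngtP i i'; [by right; exact: gap|by left; exact: gap|].
subst i'; move: ne; rewrite eqxx /= => ne.
have [jj'|j'j|jj'] := ltngtP j j'; last by rewrite jj' eqxx in ne.
- by right; move: jj'; rewrite -(ler_nat K) -natr1; lra.
- by left; move: j'j; rewrite -(ler_nat K) -natr1; lra.
Qed.

(** If the characters are F(qx) and F(q'x) with q < q', then at x = y/(q' - q) the second is
    F(qx)F(y), and F(qx) can be cancelled. *)
Lemma sine_char_neq k l : k != l -> exists2 x, small x & sine_char k x != sine_char l x.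
Proof.
have q0 (k0 : nat * nat) : 0 <= k0.2%:R + k0.1%:R * b.
  by rewrite addr_ge0 // mulr_ge0 //; lra.
have main k0 l0 : k0.2%:R + k0.1%:R * b + 1 <= l0.2%:R + l0.1%:R * b ->
    exists2 x, small x & sine_char k0 x != sine_char l0 x.
  set q := _ + _ * b; set q' := _ + _ * b => qq'.
  have c1 : 1 <= q' - q by lra.
  have y0 := smally.1.
  have sx : small (y / (q' - q)).
    apply: small_le smally; first by rewrite divr_ge0 //; lra.
    by rewrite ler_pdivrMr ?ler_peMr //; lra.
  exists (y / (q' - q)) => //; rewrite !sine_charE // -/q -/q'.
  have yE : (q' - q) * (y / (q' - q)) = y by field; lra.
  have -> : q' * (y / (q' - q)) = q * (y / (q' - q)) + y by rewrite -{3}yE; ring.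
  have qx0 : 0 <= q * (y / (q' - q)) by apply: mulr_ge0; [exact: q0|exact: sx.1].
  have qx : q * (y / (q' - q)) + y < p.
    by rewrite -{2}yE -mulrDl addrC subrK; exact: small_lt.
  have qxp : q * (y / (q' - q)) < p by lra.
  rewrite FD //; have [w Fw] := cplx_inv (F0 qx0 qxp).
  apply: contraNneq Fy => E; apply/eqP.
  by rewrite -[F y]mul1r -Fw mulrAC -E.
move=> kl; have [/main[x sx]|/main[x sx]] := infinite_gap kl; exists x => //.
by rewrite eq_sym.
Qed.

Lemma sine_independent (P : {poly {poly cplx K}}) : P != 0 ->
  exists2 x, small x & horner2 P (F x) (F (b * x)) != 0.
Proof.
move=> P0; apply: contrapT => nex.
pose m := \max_(i < size P) size (P`_i)%R.
have sP i : (size (P`_i)%R <= m)%N.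
  have [iP|iP] := ltnP i (size P).
    exact: (@leq_bigmax _ (fun i : 'I_(size P) => size (P`_i)%R) (Ordinal iP)).
  by rewrite nth_default // size_poly0.
move/eqP: P0; apply; apply/polyP => i; rewrite coef0; apply/polyP => l; rewrite coef0.
have [iP|iP] := ltnP i (size P); last by rewrite (nth_default _ iP) coef0.
have [lm|lm] := ltnP l m; last by rewrite nth_default // (leq_trans (sP i)).
pose idx (k : 'I_(size P) * 'I_m) := (val k.1, val k.2).
apply: (@artin_independence K small (cplx K) ('I_(size P) * 'I_m)%type
  (fun k => sine_char (idx k)) (index_enum _) (fun k => (P`_k.1)`_k.2)
  (@cplx_inv K) smallD _ _ _ _ _ (Ordinal iP, Ordinal lm)).
- by move=> k; exact: sine_charD.
- move=> k; exists 0; first exact: small0.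
  by rewrite sine_charE ?mulr0 ?sine_at0 ?oner_neq0 //; exact: small0.
- move=> [k1 k2] [l1 l2] kl; apply: sine_char_neq.
  by apply: contra kl => /eqP[/val_inj -> /val_inj ->].
- exact: index_enum_uniq.
- move=> x sx; rewrite -(horner2E _ _ sP); apply: contrapT => /eqP Px.
  by apply: nex; exists x.
- exact: mem_index_enum.
Qed.

End SineIndependence.


(** * Models as ordered fields *)

Section OrderedField.
Variables (F0 : Type) (fa0 : F0 -> nat) (R0 : Type) (ra0 : R0 -> nat).
Variable M : structure (Lsig fa0 ra0).

(** An alias of the domain that mentions the proof [H], so that the field and order instances built
    from [H] can be inferred from the type. *)
Definition ofield (H : OF_model M) : Type := dom M.

Variable H : OF_model M.
Local Notation R := (ofield H).

HB.instance Definition _ := gen_eqMixin R.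
HB.instance Definition _ := gen_choiceMixin R.

Let addA : associative (@Madd _ _ _ _ M : R -> R -> R). Proof. by have [] := H. Qed.
Let addC : commutative (@Madd _ _ _ _ M : R -> R -> R). Proof. by have [_ []] := H. Qed.
Let add0 : left_id (Mzero M : R) (@Madd _ _ _ _ M). Proof. by have [_ [_ []]] := H. Qed.
Let addN : left_inverse (Mzero M : R) (@Mopp _ _ _ _ M) (@Madd _ _ _ _ M).
Proof. by have [_ [_ [_ []]]] := H. Qed.

HB.instance Definition _ := GRing.isZmodule.Build R addA addC add0 addN.

Let mulA : associative (@Mmul _ _ _ _ M : R -> R -> R).
Proof. by have [_ [_ [_ [_ []]]]] := H. Qed.
Let mulC : commutative (@Mmul _ _ _ _ M : R -> R -> R).
Proof. by have [_ [_ [_ [_ [_ []]]]]] := H. Qed.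
Let mul1 : left_id (Mone M : R) (@Mmul _ _ _ _ M).
Proof. by have [_ [_ [_ [_ [_ [_ []]]]]]] := H. Qed.
Let mulDl : left_distributive (@Mmul _ _ _ _ M : R -> R -> R) +%R.
Proof.
have [_ [_ [_ [_ [_ [_ [_ [D _]]]]]]]] := H.
by move=> x y z; rewrite ![Mmul _ z]mulC; exact: D.
Qed.
Let one0 : (Mone M : R) != 0.
Proof. by apply/eqP; have [_ [_ [_ [_ [_ [_ [_ [_ []]]]]]]]] := H. Qed.

HB.instance Definition _ :=
  GRing.Zmodule_isComNzRing.Build R mulA mulC mul1 mulDl one0.

Let inv_ex (x : R) : exists y : R, if x == 0 then y = 0 else y * x = 1.
Proof.
case: eqP => [_|x0]; first by exists 0.
have [_ [_ [_ [_ [_ [_ [_ [_ [_ [+ _]]]]]]]]]] := H.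
by move=> /(_ x x0)[y xy]; exists y; rewrite [LHS]mulrC.
Qed.

Definition ofield_inv (x : R) : R := projT1 (cid (inv_ex x)).

Let mulVx (x : R) : x != 0 -> ofield_inv x * x = 1.
Proof. by move=> x0; rewrite /ofield_inv; case: cid => y /=; rewrite (negbTE x0). Qed.

Let inv0 : ofield_inv 0 = 0.
Proof. by rewrite /ofield_inv; case: cid => y /=; rewrite eqxx. Qed.

HB.instance Definition _ := GRing.ComNzRing_isField.Build R mulVx inv0.

Definition olt (x y : R) : bool := `[< Mlt x y >].
Definition ole (x y : R) : bool := (x == y) || olt x y.
Definition onorm (x : R) : R := if olt 0 x then x else - x.

Let ltxx (x : R) : ~~ olt x x.
Proof. by apply/asboolP; have [_ [_ [_ [_ [_ [_ [_ [_ [_ [_ [+ _]]]]]]]]]]] := H; exact. Qed.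
Let lt_tr (y x z : R) : olt x y -> olt y z -> olt x z.
Proof.
move=> /asboolP xy /asboolP yz; apply/asboolP.
by have [_ [_ [_ [_ [_ [_ [_ [_ [_ [_ [_ [+ _]]]]]]]]]]]] := H; move=> /(_ x y z); apply.
Qed.
Let lt_tot (x y : R) : [\/ olt x y, x = y | olt y x].
Proof.
have [_ [_ [_ [_ [_ [_ [_ [_ [_ [_ [_ [_ [+ _]]]]]]]]]]]]] := H; move=> /(_ x y).
case=> [xy|[->|yx]]; first by constructor 1; apply/asboolP.
  by constructor 2.
by constructor 3; apply/asboolP.
Qed.
Let lt_add (x y z : R) : olt x y -> olt (x + z) (y + z).
Proof.
move=> /asboolP xy; apply/asboolP.
by have [_ [_ [_ [_ [_ [_ [_ [_ [_ [_ [_ [_ [_ [+ _]]]]]]]]]]]]]] := H; apply.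
Qed.
Let lt_mul (x y : R) : olt 0 x -> olt 0 y -> olt 0 (x * y).
Proof.
move=> /asboolP x0 /asboolP y0; apply/asboolP.
by have [_ [_ [_ [_ [_ [_ [_ [_ [_ [_ [_ [_ [_ [_ +]]]]]]]]]]]]]] := H; apply.
Qed.

Let lt_addp (x y : R) : olt 0 x -> olt 0 y -> olt 0 (x + y).
Proof.
move=> x0 y0; apply: lt_tr y0 _.
by have := lt_add y x0; rewrite add0r.
Qed.

Let lt_asym (x : R) : olt 0 x -> ~~ olt x 0.
Proof. by move=> x0; apply: contraNN (ltxx 0); exact: lt_tr. Qed.

Let lt_sub (x y : R) : olt 0 (y - x) = olt x y.
Proof.
apply/idP/idP => [/(lt_add x)|/(lt_add (- x))]; first by rewrite add0r subrK.
by rewrite subrr.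
Qed.

Let lt0_tot (x : R) : x != 0 -> olt 0 x || olt x 0.
Proof. by move=> x0; case: (lt_tot 0 x) x0 => [->|->|->] //; rewrite ?eqxx ?orbT. Qed.

Let lt0N (x : R) : olt 0 (- x) = olt x 0.
Proof. by rewrite -[- x]sub0r lt_sub. Qed.

Let normN' (x : R) : onorm (- x) = onorm x.
Proof.
rewrite /onorm lt0N opprK; have [->|x0] := eqVneq x 0; first by rewrite oppr0 !if_same.
have [xp|xn] := boolP (olt 0 x); first by rewrite (negbTE (lt_asym xp)).
by have := lt0_tot x0; rewrite (negbTE xn) /= => ->.
Qed.

Let ge0_norm' (x : R) : ole 0 x -> onorm x = x.
Proof. by case/orP => [/eqP <-|x0]; rewrite /onorm ?x0 // oppr0 if_same. Qed.

HB.instance Definition _ := Num.IntegralDomain_isLtReal.Build R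
  lt_addp lt_mul lt_asym lt_sub lt0_tot normN' ge0_norm' (fun x y => erefl).

Lemma ofield_ltP (x y : R) : reflect (Mlt x y) (x < y).
Proof. exact: asboolP. Qed.

Lemma ofield_leP (x y : R) : reflect (~ Mlt y x) (x <= y).
Proof. by rewrite leNgt; apply: (iffP negP) => h /ofield_ltP. Qed.


End OrderedField.


(** * The restricted sine in a model *)

Section RestrictedSine.
Variables (F0 : Type) (fa0 : F0 -> nat) (R0 : Type) (ra0 : R0 -> nat).
Variables (M : structure (Lsig fa0 ra0)) (H : OF_model M).
Local Notation R := (ofield H).

Definition sine (x : R) : cplx R := (Msin x : R, Mcos x : R).
Definition period : R := twopi M.

Hypothesis S : defines_rsine_in M.

Lemma period_gt0 : 0 < period.
Proof.
have [/(@ofield_ltP _ _ _ _ M H 0) pi0 _] := S.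
by rewrite -[period]/((Mpi M : R) + Mpi M) addr_gt0.
Qed.

Lemma inDP (x : R) : inD x <-> 0 <= x /\ x < period.
Proof.
split=> -[h1 h2].
  by split; [apply/(ofield_leP (H := H))|apply/(ofield_ltP (H := H))].
by split; [apply/(ofield_leP (H := H))|apply/(ofield_ltP (H := H))].
Qed.

Lemma sine_add (x y : R) : 0 <= x -> 0 <= y -> x + y < period ->
  sine (x + y) = sine x * sine y.
Proof.
move=> x0 y0 xyp; have [_ [_ [FD _]]] := S.
have Dx : inD x by apply/inDP; split=> //; lra.
have Dy : inD y by apply/inDP; split=> //; lra.
have := FD x y (Madd x y) Dx Dy; rewrite /sine => FDxy.
have [] : Fsc (Madd x y) = cmul (Fsc x) (Fsc y).
  by apply: FDxy; split=> // -[]; exact/(ofield_ltP (H := H)).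
rewrite /cmul /= => Es Ec; apply: quadP; rewrite qmulE /=; last exact: Ec.
by rewrite mulN1r; exact: Es.
Qed.

Lemma sine_neq0 (x : R) : 0 <= x -> x < period -> sine x != 0.
Proof.
move=> x0 xp; have [_ [F0x _]] := S; apply/eqP.
by apply: F0x; apply/inDP.
Qed.

(** Since F is not constant, F(z) differs from 1 for some z, and F(z/(n+1)) is an (n+1)-th root of
    F(z). Dividing by n+1 rather than n covers n = 0. *)
Lemma sine_neq1 (n : nat) : exists z : R, [/\ 0 <= z, n%:R * z < period & sine z != 1].
Proof.
have [_ [_ [_ [x [y [Dx [Dy Fxy]]]]]]] := S.
have [z Dz Fz] : exists2 z : R, inD z & sine z != 1.
  have [Fx1|Fx1] := eqVneq (sine x) 1; last by exists x.
  exists y => //; apply/eqP => Fy1; apply: Fxy.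
  by move: Fx1; rewrite -Fy1.
have /inDP[z0 zp] := Dz; have n0 : 0 < n.+1%:R :> R by rewrite ltr0n.
have w0 : 0 <= z / n.+1%:R by rewrite divr_ge0.
have wz : n.+1%:R * (z / n.+1%:R) = z by rewrite mulrC divfK // gt_eqF.
exists (z / n.+1%:R); split=> //.
  by apply: le_lt_trans zp; rewrite -[leRHS]wz ler_wpM2r // ler_nat.
apply: contraNneq Fz => w1; apply/eqP; rewrite -wz.
by rewrite (sine_mulrn period_gt0 sine_add sine_neq0) ?wz // w1 expr1n.
Qed.

End RestrictedSine.

(** Real and imaginary parts of the rule, in the shape in which the formula [violation] states
    them. *)
Lemma cplx_log_eqP (A : comNzRingType) (s c s' c' ds dc ds' dc' b : A) :
  s * ds' - c * dc' = b * (s' * ds - c' * dc) /\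
  s * dc' + c * ds' = b * (s' * dc + c' * ds) <->
  ((s, c) : cplx A) * (ds', dc') = ((b, 0) : cplx A) * (s', c') * (ds, dc).
Proof.
split=> [[E1 E2]|E].
  apply: quadP; rewrite !qmulE /=; last by rewrite E2; ring.
  by transitivity (s * ds' - c * dc'); [ring|rewrite E1; ring].
move: (congr1 fst E) (congr1 snd E); rewrite !qmulE /= => E1 E2.
split; last by rewrite E2; ring.
by transitivity (s * ds' + -1 * (c * dc')); [ring|rewrite E1; ring].
Qed.

(** * The violated rule as an existential formula *)

Section Violation.
Variables (F0 : Type) (fa0 : F0 -> nat) (R0 : Type) (ra0 : R0 -> nat).
Local Notation L' := (sigMd (Lsig fa0 ra0)).

(* [b] violates the rule F'(bx)/F(bx) = b F'(x)/F(x) for the logarithmic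
   derivatives, which every derivation obeys when [b] is a natural number. *)
Definition violates (N : structure L') (H : OF_model (reduct N)) (b : ofield H) :=
  let d := cplx_der (@Mdelta _ _ _ _ N : ofield H -> ofield H) in
  exists x : ofield H, [/\ 0 <= x, b * x < period H &
    sine (x : ofield H) * d (sine (b * x)) <>
    ((b, 0) : cplx (ofield H)) * sine (b * x) * d (sine x)].

Definition tsin (t : term L') : term L' := @App L' (Some (inl Fsin)) (args1 t).
Definition tcos (t : term L') : term L' := @App L' (Some (inl Fcos)) (args1 t).
Definition topp (t : term L') : term L' := @App L' (Some (inl Fopp)) (args1 t).
Definition tpi : term L' := @App L' (Some (inl Fpi)) args0.
Definition tzero : term L' := @App L' (Some (inl Fzero)) args0.
Definition flt (t u : term L') : formula L' := @Relf L' (inl None) (args2 t u).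
Definition fneg (p : formula L') : formula L' := Imp p Fal.

(** One existential quantifier before a quantifier-free matrix, the form that [ec_model] can pull
    back. [Var 0] stays free for the multiplier [b], which Los then replaces by its coordinates. *)
Definition violation : formula L' :=
  let b : term L' := Var 0 in let x : term L' := Var 1 in
  let s := tsin x in let c := tcos x in
  let s' := tsin (tmul b x) in let c' := tcos (tmul b x) in
  Exf 1 (Andf (fneg (flt x tzero)) (Andf (flt (tmul b x) (tadd tpi tpi)) (fneg (Andf
    (Eqf (tadd (tmul s (tdelta s')) (topp (tmul c (tdelta c'))))
         (tmul b (tadd (tmul s' (tdelta s)) (topp (tmul c' (tdelta c))))))
    (Eqf (tadd (tmul s (tdelta c')) (tmul c (tdelta s')))
         (tmul b (tadd (tmul s' (tdelta c)) (tmul c' (tdelta s))))))))).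

Section Sat.
Variables (N : structure L') (rho : nat -> dom N).

Lemma eval_tsin t : eval rho (tsin t) = @Msin _ _ _ _ (reduct N) (eval rho t).
Proof. by []. Qed.
Lemma eval_tcos t : eval rho (tcos t) = @Mcos _ _ _ _ (reduct N) (eval rho t).
Proof. by []. Qed.
Lemma eval_topp t : eval rho (topp t) = @Mopp _ _ _ _ (reduct N) (eval rho t).
Proof. by []. Qed.
Lemma eval_tpi : eval rho tpi = Mpi (reduct N).
Proof. by rewrite /= (fun_args0 (fun i => _)). Qed.
Lemma eval_tzero : eval rho tzero = Mzero (reduct N).
Proof. by rewrite /= (fun_args0 (fun i => _)). Qed.
Lemma sat_flt t u :
  sat rho (flt t u) = @Mlt _ _ _ _ (reduct N) (eval rho t) (eval rho u).
Proof. by rewrite /= (fun_args2 (eval rho)). Qed.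

Definition eval_simp := (eval_tsin, eval_tcos, eval_topp, eval_tpi, eval_tzero,
  eval_tadd, eval_tmul, eval_tdelta).

End Sat.

Lemma sat_violation (N : structure L') (H : OF_model (reduct N)) (rho : nat -> dom N) :
  sat rho violation <-> @violates N H (rho 0%N).
Proof.
rewrite /violates; set R := ofield H; set b : R := rho 0%N.
pose dl : R -> R := @Mdelta _ _ _ _ N.
have body (x : R) : sat (upd rho 1 x) (fneg (Andf
    (Eqf (tadd (tmul (tsin (Var 1)) (tdelta (tsin (tmul (Var 0) (Var 1)))))
           (topp (tmul (tcos (Var 1)) (tdelta (tcos (tmul (Var 0) (Var 1)))))))
         (tmul (Var 0) (tadd (tmul (tsin (tmul (Var 0) (Var 1))) (tdelta (tsin (Var 1))))
            (topp (tmul (tcos (tmul (Var 0) (Var 1))) (tdelta (tcos (Var 1))))))))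
    (Eqf (tadd (tmul (tsin (Var 1)) (tdelta (tcos (tmul (Var 0) (Var 1)))))
            (tmul (tcos (Var 1)) (tdelta (tsin (tmul (Var 0) (Var 1))))))
         (tmul (Var 0) (tadd (tmul (tsin (tmul (Var 0) (Var 1))) (tdelta (tcos (Var 1))))
            (tmul (tcos (tmul (Var 0) (Var 1))) (tdelta (tsin (Var 1)))))))))
   <-> sine x * cplx_der dl (sine (b * x)) <>
    ((b, 0) : cplx R) * sine (b * x) * cplx_der dl (sine x).
  rewrite /fneg /sat -/(@sat _ _ _ _) !eval_simp.
  set s : R := Msin x; set c : R := Mcos x.
  set s' : R := @Msin _ _ _ _ (reduct N) (b * x).
  set c' : R := @Mcos _ _ _ _ (reduct N) (b * x).
  have E := cplx_log_eqP s c s' c' (dl s) (dl c) (dl s') (dl c') b.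
  by split=> h /E.
have x0E (x : R) : sat (upd rho 1 x) (fneg (flt (Var 1) tzero)) <-> 0 <= x.
  have -> : sat (upd rho 1 x) (fneg (flt (Var 1) tzero)) =
    ~ sat (upd rho 1 x) (flt (Var 1) tzero) by [].
  by rewrite sat_flt eval_tzero; split=> /(ofield_leP (H := H)).
have xpE (x : R) : sat (upd rho 1 x) (flt (tmul (Var 0) (Var 1)) (tadd tpi tpi)) <->
    b * x < period H.
  by rewrite sat_flt !eval_simp; split=> /(ofield_ltP (H := H)).
by split=> [[x [/x0E x0 [/xpE xp /body viol]]]|[x [/x0E x0 /xpE xp /body viol]]];
  exists x.
Qed.

End Violation.


(** * Fields of ultrapowers *)

Section UltrapowerField.
Variables (F0 : Type) (fa0 : F0 -> nat) (R0 : Type) (ra0 : R0 -> nat).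
Variables (K : structure (Lsig fa0 ra0)) (HK : OF_model K).
Variables (I : Type) (U : set_system I).
Hypothesis UU : UltraFilter U.
Local Notation K' := (ultraproduct U (fun _ : I => K)).
Variable HK' : OF_model K'.
Local Notation R := (ofield HK).
Local Notation R' := (ofield HK').

(** Sequences are sent into the field of the ultrapower; the lemmas below restate the atomic cases
    of Los in ring notation. *)
Definition ulim (f : I -> R) : R' := ucl U (f : forall i : I, dom K).

Lemma ulim_eq f g : ulim f = ulim g <-> U [set i | f i = g i].
Proof. exact: ucl_eq. Qed.

Lemma ulim_fint2 (b : bfun) (s : 'I_(bfun_ar b) -> I -> R) :
  fint K' (inl b) (fun k => ulim (s k)) = ulim (fun i => fint K (inl b) (fun k => s k i)).
Proof. exact: (fint_ucl UU (f := inl b : sfun (Lsig fa0 ra0))). Qed.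

Lemma ulim_sin f : Msin (ulim f) = ulim (fun i => Msin (f i)).
Proof. exact: (@ulim_fint2 Fsin (args1 f)). Qed.

Lemma ulim_cos f : Mcos (ulim f) = ulim (fun i => Mcos (f i)).
Proof. exact: (@ulim_fint2 Fcos (args1 f)). Qed.

Lemma ulimN f : - ulim f = ulim (fun i => - f i).
Proof. exact: (@ulim_fint2 Fopp (args1 f)). Qed.

Let args2E (f g : I -> R) :
  args2 (ulim f) (ulim g) = fun k => ulim (args2 f g k).
Proof. by rewrite (fun_args2 ulim). Qed.

Let args2E' (f g : I -> R) i :
  (fun k => args2 f g k i) = args2 (f i) (g i).
Proof. exact: (fun_args2 (fun f : I -> R => f i)). Qed.

Lemma ulimD f g : ulim f + ulim g = ulim (fun i => f i + g i).
Proof.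
rewrite -[LHS]/(fint K' (inl Fadd) (args2 (ulim f) (ulim g))) args2E.
rewrite (@ulim_fint2 Fadd); congr ulim; apply: funext => i.
by rewrite args2E'.
Qed.

Lemma ulimM f g : ulim f * ulim g = ulim (fun i => f i * g i).
Proof.
rewrite -[LHS]/(fint K' (inl Fmul) (args2 (ulim f) (ulim g))) args2E.
rewrite (@ulim_fint2 Fmul); congr ulim; apply: funext => i.
by rewrite args2E'.
Qed.

Lemma ulim0 : 0 = ulim (fun=> 0).
Proof. by rewrite -[0](subrr (ulim (fun=> 0))) ulimN ulimD; congr ulim; apply: funext => i; rewrite subrr. Qed.

Lemma ulim1 : 1 = ulim (fun=> 1).
Proof.
have const0 (a : 'I_0 -> dom K') : a = (fun k => ulim (args0 k)).
  by rewrite (fun_args0 a); apply: esym; apply: fun_args0.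
transitivity (fint K' (inl Fone) (fun k => ulim (args0 k))).
    exact: (congr1 (fint K' (inl Fone)) (const0 args0)).
  rewrite (@ulim_fint2 Fone).
by congr ulim; apply: funext => i; congr (fint K _ _); apply: fun_args0.
Qed.

Lemma ulim_period : period HK' = ulim (fun=> period HK).
Proof.
have const0 (a : 'I_0 -> dom K') : a = (fun k => ulim (args0 k)).
  by rewrite (fun_args0 a); apply: esym; apply: fun_args0.
have piE : (Mpi K' : R') = ulim (fun=> Mpi K).
  transitivity (fint K' (inl Fpi) (fun k => ulim (args0 k))).
    exact: (congr1 (fint K' (inl Fpi)) (const0 args0)).
  rewrite (@ulim_fint2 Fpi).
  by congr ulim; apply: funext => i; congr (fint K _ _); apply: fun_args0.
by rewrite -[LHS]/((Mpi K' : R') + (Mpi K' : R')) piE ulimD.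
Qed.

Lemma ulim_natr n : n%:R = ulim (fun=> n%:R).
Proof.
elim: n => [|n IH]; first exact: ulim0.
rewrite -natr1 IH ulim1 ulimD; congr ulim; apply: funext => i.
by rewrite natr1.
Qed.

Lemma ulim_lt f g : ulim f < ulim g <-> U [set i | f i < g i].
Proof.
have E : (ulim f < ulim g) <-> @rint _ K' None (fun k => ulim (args2 f g k)).
  by rewrite -args2E; split=> /(ofield_ltP (H := HK')).
rewrite E (rint_ucl UU (r := None : srel (Lsig fa0 ra0))).
by split; apply: filterS => i /=; rewrite args2E'; move/(ofield_ltP (H := HK)).
Qed.

Lemma ulim_le f g : ulim f <= ulim g <-> U [set i | f i <= g i].
Proof.
rewrite leNgt -(rwP negP) ulim_lt -ultra_not.
by split; apply: filterS => i /=; rewrite leNgt => /negP.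
Qed.

Definition diag (a : R) : R' := ulim (fun=> a).

Lemma diag_additive : zmod_morphism diag.
Proof. by move=> x y; rewrite /diag ulimN ulimD. Qed.
Lemma diag_multiplicative : monoid_morphism diag.
Proof. by split=> [|x y]; rewrite /diag ?ulimM // -ulim1. Qed.
HB.instance Definition _ := GRing.isZmodMorphism.Build R R' diag diag_additive.
HB.instance Definition _ := GRing.isMonoidMorphism.Build R R' diag diag_multiplicative.

Definition culim (f : I -> cplx R) : cplx R' :=
  (ulim (fun i => (f i).1), ulim (fun i => (f i).2)).

Lemma culimD f g : culim f + culim g = culim (fun i => f i + g i).
Proof. by apply: quadP; rewrite /= ulimD. Qed.

Lemma culimM f g : culim f * culim g = culim (fun i => f i * g i).
Proof.
apply: quadP; rewrite /=; last by rewrite !ulimM ulimD.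
rewrite mulN1r !ulimM ulimN ulimD; congr ulim; apply: funext => i.
by rewrite mulN1r.
Qed.

Lemma culim_const z : cplx_map diag z = culim (fun=> z).
Proof. by []. Qed.

Lemma culim0 : 0 = culim (fun=> 0).
Proof. by apply: quadP; exact: ulim0. Qed.

Lemma culim_sine f : sine (ulim f) = culim (fun i => sine (f i)).
Proof. by apply: quadP; [exact: ulim_sin|exact: ulim_cos]. Qed.

Lemma culim_horner (p : {poly cplx R}) f :
  (map_poly (cplx_map diag) p).[culim f] = culim (fun i => p.[f i]).
Proof.
elim/poly_ind: p => [|p c IH].
  rewrite rmorph0 horner0 culim0.
  by congr culim; apply: funext => i; rewrite horner0.
rewrite rmorphD rmorphM /= map_polyX map_polyC /= hornerMXaddC IH culim_const culimM culimD.
by congr culim; apply: funext => i; rewrite hornerMXaddC.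
Qed.

Lemma culim_horner2 (P : {poly {poly cplx R}}) f g :
  horner2 (map_poly (map_poly (cplx_map diag)) P) (culim f) (culim g) =
  culim (fun i => horner2 P (f i) (g i)).
Proof.
rewrite /horner2; elim/poly_ind: P => [|P c IH].
  rewrite rmorph0 !horner0 culim0.
  by congr culim; apply: funext => i; rewrite !horner0.
rewrite rmorphD rmorphM /= map_polyX map_polyC /= hornerMXaddC hornerD hornerM hornerC.
rewrite IH culim_horner culimM culimD.
by congr culim; apply: funext => i; rewrite hornerMXaddC hornerD hornerM hornerC.
Qed.

Lemma culim_eq f g : culim f = culim g <-> U [set i | f i = g i].
Proof.
split=> [E|E].
  have /ulim_eq E1 := congr1 fst E; have /ulim_eq E2 := congr1 snd E.
  by apply: filterS (filterI E1 E2) => i [/= e1 e2]; apply: quadP.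
by apply: quadP; apply/ulim_eq; apply: filterS E => i /= ->.
Qed.

Definition diag_rmorphism : {rmorphism R -> R'} := diag.

End UltrapowerField.


(** Applied twice, for the inner and the outer variable, to polynomials over [cplx R]. *)
Lemma poly_mul_neq0 (A : comNzRingType) :
  (forall x y : A, x != 0 -> y != 0 -> x * y != 0) ->
  forall p q : {poly A}, p != 0 -> q != 0 -> p * q != 0.
Proof.
move=> A0 p q p0 q0.
have lpq : lead_coef p * lead_coef q != 0 by apply: A0; rewrite lead_coef_eq0.
by rewrite -lead_coef_eq0 lead_coef_proper_mul.
Qed.

Lemma cplx_natrE (R : comNzRingType) n : n%:R = (n%:R, 0) :> cplx R.
Proof.
elim: n => // n IH; rewrite -natr1 IH; apply: quadP => /=; first by rewrite natr1.
by rewrite addr0.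
Qed.

Lemma ultrapower_small (F0 : Type) (fa0 : F0 -> nat) (R0 : Type) (ra0 : R0 -> nat)
    (K : structure (Lsig fa0 ra0)) (H : OF_model K) (S : defines_rsine_in K)
    (U : set_system nat) (UU : UltraFilter U)
    (Uoo : forall n, U [set m | (n <= m)%N])
    (H' : OF_model (ultraproduct U (fun=> K))) :
  let b : ofield H' := ulim H' (fun n => n%:R : ofield H) in
  (forall n : nat, n%:R <= b) /\
  exists2 y : ofield H', small (period H') b y & sine y != 1.
Proof.
move=> b; split=> [n|].
  rewrite (ulim_natr H UU H'); apply/(ulim_le UU).
  by apply: filterS (Uoo n) => m /=; rewrite ler_nat.
(* The square serves smallness: for m >= n one has n m z_m <= m m z_m < period, and [b] has m-th
   coordinate m. *)
have [z zP] := choice (fun n => sine_neq1 H S (n * n)).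
exists (ulim H' z).
  split=> [|n].
    rewrite (ulim0 H UU H'); apply/(ulim_le UU).
    by apply: filterS filterT => m _; case: (zP m).
  have -> : n%:R * b * ulim H' z = ulim H' (fun m => n%:R * m%:R * z m).
    by rewrite (ulim_natr H UU H') /b (ulimM UU) (ulimM UU).
  rewrite (ulim_period H UU); apply/(ulim_lt UU).
  apply: filterS (Uoo n) => m /= nm; have [z0 zp _] := zP m.
  by apply: le_lt_trans zp; rewrite -natrM ler_wpM2r // ler_nat leq_mul2r nm orbT.
rewrite (culim_sine UU) -(rmorph1 (cplx_map (diag_rmorphism H UU H'))).
apply/eqP => /(culim_eq UU)/filter_ex[m /= zm1].
by have [_ _ /eqP] := zP m; apply.
Qed.

(** * Violating extensions and the contradiction *)

Section NoGenericDerivations.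
Variables (F0 : Type) (fa0 : F0 -> nat) (R0 : Type) (ra0 : R0 -> nat).
Variable T : theory (Lsig fa0 ra0).
Hypotheses (TOF : expands_OF T) (TS : defines_rsine T).
Local Notation L' := (sigMd (Lsig fa0 ra0)).

Lemma zero_derivation_model (M : structure (Lsig fa0 ra0)) : models T M ->
  models (TMdelta T) (expansion (fun _ : dom M => Mzero M)).
Proof.
(* The reduct of an expansion of [M] is [M] only up to eta for records; destructing [M] makes them
   convertible. *)
case: M => D f r MT; have H := TOF MT.
apply/models_TMdelta; split=> //; first exact: morley_model_expansion.
split=> x y.
  exact: (esym (addr0 (0 : ofield H))).
have E : (0 : ofield H) = (x : ofield H) * 0 + (y : ofield H) * 0.
  by rewrite !mulr0 addr0.
exact: E.
Qed.

(** F(nx) = F(x)^n, and the rule becomes the power rule [derX]. *)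
Lemma natural_not_violates (N : structure L') (H : OF_model (reduct N)) n :
  models (TMdelta T) N -> ~ @violates _ _ _ _ N H n%:R.
Proof.
move=> /models_TMdelta[NT _ dN] [x [x0 nx]]; have S := TS NT; apply.
have dD : is_derivation (@Mdelta _ _ _ _ N : ofield H -> ofield H) := dN.
have cD := cplx_derP dD.
rewrite (sine_mulrn (period_gt0 H S) (sine_add S) (sine_neq0 S)) //.
by rewrite (derX cD) cplx_natrE.
Qed.

(** The ultrapower is indexed by the domain of [K] itself, and the class of the identity is the
    generic small point: a polynomial relation there would hold at almost all x, which the choice of
    ultrafilter excludes. *)
Lemma violating_extension (M : structure L') (H : OF_model (reduct M)) (b y : ofield H) :
  models (TMdelta T) M -> (forall n : nat, n%:R <= b) ->
  small (period H) b y -> sine y != 1 ->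
  exists (N : structure L') (h : dom M -> dom N) (HN : OF_model (reduct N)),
    [/\ models (TMdelta T) N, embedding h & @violates _ _ _ _ N HN (h b)].
Proof.
move=> MT binf smally Fy; have /models_TMdelta[KT Mm dM] := MT.
set K := reduct M in H b y KT dM binf smally Fy *; set R := ofield H.
have S := TS KT.
have indep := sine_independent (period_gt0 H S) (sine_add S) (sine_neq0 S) binf smally Fy.
have cplx_mul (z w : cplx R) : z != 0 -> w != 0 -> z * w != 0.
  move=> z0; apply: contra_neq; apply: mul_eq0l z0; exact: cplx_inv.
(* These sets are directed: the one for a product [P * Q] lies in those for [P] and [Q]. *)
pose B (P : {P : {poly {poly cplx R}} | P != 0}) : set (dom K) :=
  [set x : R | small (period H) b x /\ horner2 (sval P) (sine x) (sine (b * x)) != 0].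
have [||| V [VV VB]] := @directed_ultrafilter _ _ B.
- by exists (exist _ 1 (oner_neq0 _)).
- move=> [P P0] [Q Q0].
  have PQ0 : P * Q != 0 by apply: poly_mul_neq0 => //; exact: poly_mul_neq0.
  exists (exist _ (P * Q) PQ0) => x [/= sx PQx].
  by split; split=> //=; apply: contraNneq PQx; rewrite /horner2 !hornerM => ->;
    rewrite ?mul0r ?mulr0.
- by move=> [P P0]; have [x sx Px] := indep P P0; exists x.
pose K' := ultraproduct V (fun _ : dom K => K).
have K'T : models T K' by apply: models_ultraproduct.
have H' : OF_model K' := TOF K'T.
pose R' := ofield H'.
pose h : {rmorphism R -> R'} := diag_rmorphism H VV H'.
pose x : R' := ulim (HK := H) H' id.
have Vsmall : V [set x : R | small (period H) b x].
  by apply: filterS (VB (exist _ 1 (oner_neq0 _))) => z [].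
have bxE : h b * x = ulim (HK := H) H' (fun x : R => b * x) by exact: ulimM.
pose u := sine (H := H') x; pose v := sine (h b * x).
have uE : u = culim (HK := H) H' (fun x : R => sine x) by exact: culim_sine.
have vE : v = culim (HK := H) H' (fun x : R => sine (b * x)).
  by rewrite /v bxE culim_sine.
have u0 : u != 0.
  rewrite uE (culim0 H VV H'); apply/eqP => /(culim_eq VV) Vs0.
  have [z [/= [z0 zp] /eqP]] := filter_ex (filterI Vsmall Vs0).
  apply/negP; apply: (sine_neq0 S) => //.
  have := zp 1%N; rewrite mul1r; apply: le_lt_trans.
  by rewrite ler_peMl //; exact: (binf 1%N).
have indep' (P : {poly {poly cplx R}}) : P != 0 ->
    horner2 (map_poly (map_poly (cplx_map h)) P) u v != 0.
  move=> P0; have -> : horner2 (map_poly (map_poly (cplx_map h)) P) u v =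
      culim (HK := H) H' (fun x : R => horner2 P (sine x) (sine (b * x))).
    by rewrite uE vE; exact: culim_horner2.
  rewrite (culim0 H VV H'); apply/eqP => /(culim_eq VV) Vs0.
  by have [z [/= [_ /eqP]]] := filter_ex (filterI (VB (exist _ P P0)) Vs0).
have [d [dD dh viol]] := log_derivative_violation b
  (dM : is_derivation (@Mdelta _ _ _ _ M : R -> R)) u0 indep'.
exists (@expansion _ K' d), h, H'; split.
- apply/models_TMdelta; split=> //; exact: morley_model_expansion.
- apply: embedding_expansion => //.
  + by apply: embedding_ultraproduct => i; exact: embedding_id.
  (* The diagonal map is elementary by Los, applied to constant sections. *)
  + move=> phi rho; have := @los _ _ V (fun=> K) VV (fun n _ => rho n) phi.
    move=> ->; split=> [Hs|/filter_ex[] //].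
    by apply: filterS filterT.
exists x; split=> //.
- rewrite (ulim0 H VV H'); apply/(ulim_le VV).
  by apply: filterS Vsmall => z [].
- rewrite bxE (ulim_period H VV); apply/(ulim_lt VV).
  by apply: filterS Vsmall => z [_ /(_ 1%N)]; rewrite mul1r.
Qed.

(** A model of [T] with the zero derivation starts the construction; for an inconsistent [T] the
    class of existentially closed models would be empty and hence elementary. *)
Lemma no_generic_derivations : (exists M, models T M) -> ~ admits_generic_derivations T.
Proof.
move=> [M0 M0T] [Sigma SigmaP].
have [|M Mec] := ec_model_ex (zero_derivation_model M0T).
  by exists (Mzero M0).
have /models_TMdelta[KT _ _] := Mec.1; have H := TOF KT.
have [||| U [UU Uoo]] := @directed_ultrafilter nat nat (fun n => [set m | (n <= m)%N]).
- by exists 0%N.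
- move=> j k; exists (maxn j k) => m /=.
  by rewrite geq_max => /andP[].
- by move=> j; exists j => /=.
pose M' := ultraproduct U (fun=> M).
have M'ec : ec_model (TMdelta T) M'.
  by apply/SigmaP; apply: models_ultraproduct => _; apply/SigmaP.
(* The reduct of the ultrapower is, by conversion, the ultrapower of the reduct, so the results on
   fields of ultrapowers apply to it. *)
have /models_TMdelta[K'T _ _] := M'ec.1; pose K' := ultraproduct U (fun=> reduct M).
have H' : OF_model K' := TOF K'T.
have S := TS KT.
have [binf [y smally Fy]] := ultrapower_small H S UU Uoo H'.
set b := ulim _ _ in binf smally.
have [N [h [HN [NT hemb viol]]]] :=
  @violating_extension M' H' b y M'ec.1 binf smally Fy.
have : @sat _ M' (fun=> b) (violation fa0 ra0).
  apply: (M'ec.2 N h NT hemb) => //.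
  exact/(sat_violation HN).
move/(@los _ _ U (fun=> M) UU (fun _ n => (n%:R : ofield H)))/filter_ex => [n].
by move/(sat_violation H); exact: natural_not_violates Mec.1.
Qed.

End NoGenericDerivations.

Theorem theorem4p2 (F0 : Type) (fa0 : F0 -> nat) (R0 : Type) (ra0 : R0 -> nat)
  (T : theory (Lsig fa0 ra0)) :
  (exists M : structure (Lsig fa0 ra0), models T M) ->
  expands_OF T ->
  defines_rsine T ->
  ~ admits_generic_derivations T.
Proof.
by move=> MT TOF TS; exact: no_generic_derivations.
Qed.
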